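(* Let $D\ge 1$ be an integer. The following are equivalent: (i) $(A_3,d)$ admits a lattice diameter-perfect code of minimum distance $D+1$; (ii) $S_{3,D}$ lattice-tiles $\mathbb{Z}^3$; (iii) $D\in\{1,2\}$.
   Context: For $u\in\mathbb{R}$ put $u^+=\max\{u,0\}$. The asymmetric Manhattan metric on $\mathbb{Z}^n$ is $d_{\mathrm a}(x,y)=\max\{\sum_{i=1}^n(x_i-y_i)^+,\ \sum_{i=1}^n(y_i-x_i)^+\}$. The root lattice is $A_n=\{z=(z_0,\dots,z_n)\in\mathbb{Z}^{n+1}:\sum_{i=0}^n z_i=0\}$ with metric $d(z,w)=\frac12\sum_{i=0}^n|z_i-w_i|$; the map $(x_1,\dots,x_n)\mapsto(x_1,\dots,x_n,-\sum_i x_i)$ is a group isomorphism and an isometry from $(\mathbb{Z}^n,d_{\mathrm a})$ onto $(A_n,d)$, and the two spaces are identified through it. For nonnegative integers $P,Q$, $S_n(P,Q)=\{x\in\mathbb{Z}^n:\sum_{i}x_i^+\le P,\ \sum_{i}(-x_i)^+\le Q\}$, and $S_{n,D}=S_n(\lceil D/2\rceil,\lfloor D/2\rfloor)$. The minimum distance of a full-rank sublattice $L$ is the minimum distance between $0$ and a nonzero element of $L$. A full-rank sublattice $L\le\mathbb{Z}^n$ (equivalently, of $A_n$) of minimum distance $D+1$ is called a (lattice) diameter-perfect code if its index equals the maximum cardinality of a subset of the space of diameter at most $D$. A finite set $S\subset\mathbb{Z}^n$ lattice-tiles $\mathbb{Z}^n$ if there is a full-rank sublattice $L\le\mathbb{Z}^n$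 such that the translates $S+\ell$, $\ell\in L$, are pairwise disjoint and cover $\mathbb{Z}^n$. *)

(* Defs.v *)
From HB Require Import structures.
From mathcomp Require Import all_boot all_order all_algebra.
From mathcomp Require Import boolp classical_sets functions cardinality.

Set Implicit Arguments.
Unset Strict Implicit.
Unset Printing Implicit Defensive.

Import Order.TTheory GRing.Theory Num.Theory.
Local Open Scope classical_set_scope.
Local Open Scope card_scope.
Local Open Scope ring_scope.

(** Everything is built on Mathematical Components, with the sets and cardinals
    of [mathcomp.classical].  The group [Z^n] is ['rV[int]_n]. *)

Definition root_pred (n : nat) : {pred 'rV[int]_n.+1} :=
  fun z => \sum_i z 0 i == 0.

Lemma root_pred_zmod_closed (n : nat) : zmod_closed (@root_pred n).
Proof.
split=> [|x y]; rewrite !unfold_in.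
  by rewrite big1 // => i _; rewrite mxE.
move=> /eqP hx /eqP hy.
by under eq_bigr => i _ do rewrite !mxE; rewrite sumrB hx hy subr0.
Qed.

HB.instance Definition _ (n : nat) :=
  GRing.isZmodClosed.Build 'rV[int]_n.+1 (@root_pred n)
    (root_pred_zmod_closed n).

Record root_lattice (n : nat) : Type := RootLattice {
  root_val :> 'rV[int]_n.+1;
  root_valP : root_val \in @root_pred n
}.

HB.instance Definition _ (n : nat) := [isSub for @root_val n].
HB.instance Definition _ (n : nat) := [Choice of root_lattice n by <:].
HB.instance Definition _ (n : nat) :=
  [SubChoice_isSubZmodule of root_lattice n by <:].

Definition root_dist (n : nat) (z w : root_lattice n) : rat :=
  (\sum_i `|root_val z 0 i - root_val w 0 i|)%:~R / 2%:R.

Section Lattices.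
Variable V : zmodType.
Implicit Types (L S : set V) (d : V -> V -> rat).

Definition is_subgroup L : Prop :=
  L 0 /\ forall x y, L x -> L y -> L (x - y).

Definition Zindependent (r : nat) (b : 'I_r -> V) : Prop :=
  forall c : 'I_r -> int, \sum_i b i *~ c i = 0 -> forall i, c i = 0.

Definition has_rank L (r : nat) : Prop :=
  (exists b : 'I_r -> V, (forall i, L (b i)) /\ Zindependent b) /\
  (forall (s : nat) (b : 'I_s -> V),
     (forall i, L (b i)) -> Zindependent b -> (s <= r)%N).

(** [L] has the same, finite, rank as the ambient group. *)
Definition full_rank_sublattice L : Prop :=
  is_subgroup L /\ exists r : nat, has_rank L r /\ has_rank setT r.

Definition translate S (x : V) : set V := [set s + x | s in S].

(** The number of cosets of [L]. *)
Definition has_index L (k : nat) : Prop := range (translate L) #= `I_k.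

Definition has_min_dist d L (m : rat) : Prop :=
  (exists x, [/\ L x, x <> 0 & d 0 x = m]) /\
  (forall x, L x -> x <> 0 -> m <= d 0 x).

Definition diameter_le d S (D : rat) : Prop :=
  forall x y, S x -> S y -> d x y <= D.

Definition has_max_card_diameter d (D : rat) (k : nat) : Prop :=
  (exists2 S : set V, diameter_le d S D & S #= `I_k) /\
  (forall S : set V, diameter_le d S D -> S #<= `I_k).

Definition diameter_perfect_code d (D : nat) L : Prop :=
  [/\ full_rank_sublattice L,
      has_min_dist d L D.+1%:R
    & exists k : nat, has_index L k /\ has_max_card_diameter d D%:R k].

(** Finiteness of [S] need not be required: a set tiling [V] by a full-rank
    sublattice of [V = Z^n] has as many elements as there are cosets of it. *)
Definition lattice_tiles S : Prop :=
  exists L : set V,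
    [/\ full_rank_sublattice L,
        trivIset L (translate S)
      & \bigcup_(l in L) translate S l = setT].

End Lattices.

Definition anticode (n P Q : nat) : set 'rV[int]_n :=
  [set x | \sum_i Num.max (x 0 i) 0 <= P%:Z /\
           \sum_i Num.max (- x 0 i) 0 <= Q%:Z].
Arguments anticode : clear implicits.

(** [uphalf D] and [D./2] are the ceiling and the floor of [D / 2]. *)
Definition anticode_diam (n D : nat) : set 'rV[int]_n :=
  anticode n (uphalf D) D./2.
Arguments anticode_diam : clear implicits.

(* Main.v *)
Require Import Defs.
From HB Require Import structures.
From Stdlib Require Import ZArith Lia.
From mathcomp Require Import all_boot all_order all_algebra.
From mathcomp Require Import boolp classical_sets functions cardinality.
From mathcomp Require Import zify ssrZ ring.

(** In [A_3], a set has diameter at most [D] iff the four coordinates and the three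
    pair sums each vary by at most [D] on it.  The pair sums identify [A_3] with the
    points of even coordinate sum in [Z^3], so an anticode becomes, after translation,
    a set of points of given parity in the cube [0,D]^3 from which the eight corners
    are cut off, the depths of two opposite cuts adding up to [D].  Inclusion-exclusion
    over the corners and the edges shows that the number of points is largest when
    all depths are [D/2] up to rounding, which is [S_{3,D}].  Hence a lattice
    diameter-perfect code has index [|S_{3,D}|], and as it packs the translates of
    [S_{3,D}], it tiles by them.

    Suppose that [L] tiles by [S_{3,D}], with [D >= 3].  A point just outside [S_{3,D}]
    and over the interior of a triangular facet can only be covered by a translate
    along a vector of norm exactly [D+1] pointing into the cone of that facet, and such
    a vector is unique.  The points near the three vertices of the facet force its
    three entries to be at least [floor(D/2) - 1], while their sum is [D+1]: this is
    impossible unless [D <= 9] or [D = 11], and these cases are settled by a finite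
    search.

    For [D = 1] and [D = 2] the vectors with [a + 2b + 3c = 0 mod 4], respectively
    [a + 3b + 9c = 0 mod 13], form a tiling lattice and a diameter-perfect code. *)
Set Implicit Arguments.
Unset Strict Implicit.
Unset Printing Implicit Defensive.

Import Order.TTheory GRing.Theory Num.Theory.

(** * Tilings of [Z^3] by anticodes *)

Section IntegerTilings.
Local Open Scope Z_scope.

Definition tri := (Z * Z * Z)%type.

Definition tsub (p q : tri) : tri :=
  let '(a, b, c) := p in let '(a', b', c') := q in (a - a', b - b', c - c').

Definition topp (p : tri) : tri := tsub (0, 0, 0) p.

(* Twice the distance from [0] of the point [(a, b, c, -(a + b + c))] of [A_3]. *)
Definition tnorm (p : tri) : Z :=
  let '(a, b, c) := p in Z.abs a + Z.abs b + Z.abs c + Z.abs (a + b + c).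

Definition in_anticode (P Q : Z) (p : tri) : bool :=
  let '(a, b, c) := p in
  (Z.max a 0 + Z.max b 0 + Z.max c 0 <=? P) &&
  (Z.max (- a) 0 + Z.max (- b) 0 + Z.max (- c) 0 <=? Q).

(** Disjointness of the translates is encoded by the norm: the differences of two points of the
    anticode are exactly the vectors of norm at most [2 * (P + Q)]. *)
Definition tiling_lattice (P Q : Z) (L : tri -> Prop) : Prop :=
  [/\ L (0, 0, 0), forall p q, L p -> L q -> L (tsub p q),
      forall p, L p -> tnorm p <= 2 * (P + Q) -> p = (0, 0, 0) &
      forall p, exists q, in_anticode P Q q /\ L (tsub p q)].

(* The search below is run by [vm_compute], which is call by value: conditionals
   replace the boolean connectives so that branches are cut early. *)
Definition compatible (D : Z) (p : tri) : bool :=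
  let '(a, b, c) := p in
  if 2 * D <? tnorm p then true
  else if a =? 0 then if b =? 0 then c =? 0 else false else false.

Fixpoint forall_range (f : Z -> bool) (a : Z) (n : nat) : bool :=
  if n is n'.+1 then if f a then forall_range f (a + 1) n' else false else true.

Lemma forall_rangeP f a n : forall_range f a n ->
  forall x, a <= x < a + Z.of_nat n -> f x.
Proof.
elim: n a => [|n IH] a /=; first by move=> _ x Hx; lia.
case: ifP => // fa H x Hx; have [->|ne] := Z.eq_dec x a; first exact: fa.
by apply: (IH _ H); lia.
Qed.

Fixpoint exists_in (f : tri -> bool) (ps : seq tri) : bool :=
  if ps is p :: ps' then if f p then true else exists_in f ps' else false.

Lemma exists_inP f ps : exists_in f ps -> exists p, f p.
Proof. by elim: ps => //= p ps IH; case: ifP => // fp _; exists p. Qed.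

Fixpoint forall_in (f : tri -> bool) (ps : seq tri) : bool :=
  if ps is p :: ps' then if f p then forall_in f ps' else false else true.

(* The points of [hints] are covered one after the other, in all ways compatible
   with the lattice vectors [ls] already found, until no way is left. *)
Fixpoint refute (P Q : Z) (hints : seq tri) (n : nat) (ls : seq tri) : bool :=
  if n is n'.+1 then
    (* The coordinates of a point of the anticode lie in [[-Q, P]], which has [P + Q + 1]
       elements. *)
    let m := Z.to_nat (P + Q + 1) in
    exists_in (fun p =>
      forall_range (fun a => forall_range (fun b => forall_range (fun c =>
        if in_anticode P Q (a, b, c) then
          let l := tsub p (a, b, c) in
          if compatible (P + Q) l then
            if forall_in (fun l' => if compatible (P + Q) (tsub l l')
                  then compatible (P + Q) (tsub l (topp l')) else false) ls
            then refute P Q hints n' (l :: ls) else true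
          else true
        else true) (- Q) m) (- Q) m) (- Q) m) hints
  else false.

(** An actual lattice follows one branch of the search: the vector covering the chosen point lies in
    [L], as do its sums and differences with the earlier ones, so all tests succeed down to depth
    [0], where [refute] is [false]. *)
Lemma refuteP P Q L hints n ls : 0 <= P -> 0 <= Q -> tiling_lattice P Q L ->
  (forall l, l \in ls -> L l) -> ~ refute P Q hints n ls.
Proof.
move=> HP HQ [L0 LB pack cov].
have comp l : L l -> compatible (P + Q) l.
  case: l => [[a b] c] Ll; rewrite /compatible.
  by case: Z.ltb_spec => // H; have [-> -> ->] := pack _ Ll H.
elim: n ls => [|n IH] ls Hls //; cbn [refute] => /exists_inP[p].
have [[[a b] c] [Sq Lq]] := cov p.
have /andP[/Z.leb_le B1 /Z.leb_le B2] := Sq.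
move=> /forall_rangeP/(_ a ltac:(lia))/forall_rangeP/(_ b ltac:(lia)).
move=> /forall_rangeP/(_ c ltac:(lia)).
rewrite Sq (comp _ Lq); case: ifP => [_|/negP[]].
  by apply: IH => l; rewrite inE => /predU1P[->//|/Hls].
elim: (ls) Hls => //= l' ls' IHl Hls.
have Ll' : L l' by apply: Hls; rewrite mem_head.
rewrite (comp _ (LB _ _ Lq Ll')) (comp _ (LB _ _ Lq (LB _ _ L0 Ll'))).
by apply: IHl => l Hl; apply: Hls; rewrite inE Hl orbT.
Qed.

(* The translate covering [(-a, -b, -c)] cannot be moved by a unit in any of the three
   coordinate directions, so it touches the facet of the anticode with its opposite
   facet. *)
Lemma facet_vector P Q L a b c : 0 <= P -> tiling_lattice P Q L ->
  1 <= a -> 1 <= b -> 1 <= c -> a + b + c = Q + 1 ->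
  exists A B C, [/\ L (-A, -B, -C), a <= A, b <= B, c <= C & A + B + C = P + Q + 1].
Proof.
move=> HP [L0 LB pack cov] Ha Hb Hc Hs.
have [[[x y] z] [/andP[/Z.leb_le B1 /Z.leb_le B2] Lq]] := cov (- a, - b, - c).
have {Lq} Lq : L (- (a + x), - (b + y), - (c + z)).
  by move: Lq; rewrite /tsub; congr (L (_, _, _)); lia.
have big : 2 * (P + Q) < tnorm (- (a + x), - (b + y), - (c + z)).
  by case: (Z_lt_le_dec (2 * (P + Q)) (tnorm (- (a + x), - (b + y), - (c + z)))) => // H;
    have [] := pack _ Lq H; lia.
(* The positive parts of the entries sum to at most [(Q + 1) + P], and the norm forces equality. As
   [a], [b], [c] are positive, this excludes negative [x], [y], [z] and gives [x + y + z = P]. *)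
by exists (a + x), (b + y), (c + z); move: big; rewrite /tnorm => big; split=> //; lia.
Qed.

Lemma no_tiling_large P Q L : 0 <= P -> 2 <= Q -> P + Q + 1 < 3 * (Q - 1) ->
  ~ tiling_lattice P Q L.
Proof.
move=> HP HQ Hbig HL; have [L0 LB pack cov] := HL.
have [||||A1 [B1 [C1 [L1 ? ? ? ?]]]] := @facet_vector P Q L (Q - 1) 1 1 HP HL; try lia.
have [||||A2 [B2 [C2 [L2 ? ? ? ?]]]] := @facet_vector P Q L 1 (Q - 1) 1 HP HL; try lia.
have [||||A3 [B3 [C3 [L3 ? ? ? ?]]]] := @facet_vector P Q L 1 1 (Q - 1) HP HL; try lia.
(* Two triples of positive entries with the same sum [P + Q + 1] differ by a vector of norm at most
   [2 * (P + Q - 2)], so the three vectors coincide. *)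
have := pack _ (LB _ _ L1 L2); have := pack _ (LB _ _ L1 L3); rewrite /tsub /tnorm.
by move=> /(_ ltac:(lia))[? ? ?] /(_ ltac:(lia))[? ? ?]; lia.
Qed.

Lemma no_tiling P Q L : 0 <= Q <= P -> P <= Q + 1 -> 3 <= P + Q -> ~ tiling_lattice P Q L.
Proof.
move=> H1 H2 H3 HL.
have [Hbig|Hsmall] := Z_lt_le_dec (P + Q + 1) (3 * (Q - 1)).
  by apply: (@no_tiling_large P Q L); lia || assumption.
have R hints n : ~ refute P Q hints n [::].
  by apply: (refuteP _ _ HL); lia || move=> l.
(* The remaining inequality gives [Q <= 4] if [P = Q], and [Q <= 5] if [P = Q + 1]. *)
have : (P = 2 /\ Q = 1) \/ (P = 2 /\ Q = 2) \/ (P = 3 /\ Q = 2) \/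
  (P = 3 /\ Q = 3) \/ (P = 4 /\ Q = 3) \/ (P = 4 /\ Q = 4) \/
  (P = 5 /\ Q = 4) \/ (P = 6 /\ Q = 5) by lia.
case=> [|[|[|[|[|[|[|]]]]]]] [PE QE]; rewrite {}PE {}QE in R.
(* In every list the negative parts of each point sum to [Q + 1], one more than the anticode allows.
   Every branch dies within the given number of covered points. *)
- by apply: (R [:: (-2, 1, 1); (-2, 1, 0); (-1, 2, -1); (-2, 0, 1);
    (-1, -1, 2); (-2, 0, 2); (-1, -1, 1)] 3%N); vm_compute.
- by apply: (R [:: (-1, -1, -1); (-2, 0, -1); (-3, 1, 1); (-2, -1, 0);
    (-2, 1, -1); (-2, -1, 1)] 3%N); vm_compute.
- by apply: (R [:: (-3, 1, 1); (-3, 1, 2); (-3, 0, 1); (-3, 0, 3);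
    (-3, 2, 1)] 3%N); vm_compute.
- by apply: (R [:: (-4, 1, 1); (-4, 1, 2); (-4, 0, 1); (-4, 0, 3);
    (-4, 1, 0); (-4, 1, 3); (-4, 2, 1)] 3%N); vm_compute.
- by apply: (R [:: (-4, 1, 1); (-4, 1, 2); (-4, 1, 3); (-4, 3, 1)] 2%N); vm_compute.
- by apply: (R [:: (-5, 1, 1); (-5, 1, 2); (-5, 1, 3); (-5, 0, 1);
    (-5, 0, 4); (-5, 3, 1)] 3%N); vm_compute.
- by apply: (R [:: (-5, 1, 1); (-5, 1, 2); (-5, 1, 3); (-5, 1, 4);
    (-5, 3, 1)] 2%N); vm_compute.
- by apply: (R [:: (-6, 1, 1); (-6, 1, 2); (-6, 1, 3); (-6, 1, 4);
    (-6, 1, 5); (-6, 3, 1)] 2%N); vm_compute.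
Qed.

End IntegerTilings.

(** * Cubes with cut corners *)

Section CubeCounting.
Local Open Scope nat_scope.

Definition flip (D : nat) (a : bool) (x : nat) : nat := if a then D - x else x.

(** The Manhattan distance to the corner of [[0, D]^3] whose coordinates are [D] where the flag is
    true and [0] elsewhere. *)
Definition corner_dist (D : nat) (a b c : bool) (x y w : nat) : nat :=
  flip D a x + flip D b y + flip D c w.

(** Sets of points are counted by summing indicators, which turns inclusion-exclusion into a
    pointwise inequality between booleans. *)
Definition cube_sum (D : nat) (f : nat -> nat -> nat -> nat) : nat :=
  \sum_(x < D.+1) \sum_(y < D.+1) \sum_(w < D.+1) f x y w.

Lemma cube_sumD D f g :
  cube_sum D f + cube_sum D g = cube_sum D (fun x y w => f x y w + g x y w).
Proof.
rewrite /cube_sum -big_split; apply: eq_bigr => x _ /=.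
rewrite -big_split; apply: eq_bigr => y _ /=.
by rewrite -big_split.
Qed.

Lemma leq_cube_sum D f g :
  (forall x y w, x <= D -> y <= D -> w <= D -> f x y w <= g x y w) ->
  cube_sum D f <= cube_sum D g.
Proof.
move=> le_fg; apply: leq_sum => x _; apply: leq_sum => y _; apply: leq_sum => w _.
by apply: le_fg; rewrite -ltnS.
Qed.

Lemma eq_cube_sum D f g :
  (forall x y w, x <= D -> y <= D -> w <= D -> f x y w = g x y w) ->
  cube_sum D f = cube_sum D g.
Proof.
move=> eq_fg; apply: eq_bigr => x _; apply: eq_bigr => y _; apply: eq_bigr => w _.
by apply: eq_fg; rewrite -ltnS.
Qed.

Lemma sum_flip (D : nat) (a : bool) (f : nat -> nat) :
  \sum_(x < D.+1) f x = \sum_(x < D.+1) f (flip D a x).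
Proof.
case: a => //; rewrite (reindex_inj rev_ord_inj) /=.
by apply: eq_bigr => x _; rewrite subSS.
Qed.

Lemma cube_sum_flip (D : nat) (a b c : bool) f :
  cube_sum D f = cube_sum D (fun x y w => f (flip D a x) (flip D b y) (flip D c w)).
Proof.
rewrite /cube_sum (sum_flip D a (fun x => \sum_(y < D.+1) \sum_(w < D.+1) f x y w)).
apply: eq_bigr => x _.
rewrite (sum_flip D b (fun y => \sum_(w < D.+1) f (flip D a x) y w)).
by apply: eq_bigr => y _; rewrite (sum_flip D c).
Qed.

Lemma cube_sum_swap23 D f : cube_sum D f = cube_sum D (fun x y w => f x w y).
Proof. by apply: eq_bigr => x _; rewrite exchange_big. Qed.

Lemma cube_sum_swap12 D f : cube_sum D f = cube_sum D (fun x y w => f y x w).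
Proof. by rewrite /cube_sum exchange_big. Qed.

Lemma flipK D a x : x <= D -> flip D a (flip D a x) = x.
Proof. by case: a => //= ?; rewrite subKn. Qed.

Lemma flip_flipC D a x : x <= D -> flip D (~~ a) (flip D a x) = D - x.
Proof. by case: a => //= ?; rewrite subKn. Qed.

Lemma flip_le D a x : x <= D -> flip D a x <= D.
Proof. by case: a => //= _; rewrite leq_subr. Qed.

(** * Sizes of the cuts and of their overlaps along edges *)

Fixpoint partial_sum (g : nat -> nat) (s : nat) : nat :=
  if s is s'.+1 then partial_sum g s' + g s else 0.

(** Subtraction is truncated: the terms with [y >= s] are [g 0], and the others are
    [g s, ..., g 1]. *)
Lemma sum_sub_partial (g : nat -> nat) n s : g 0 = 0 -> s <= n ->
  \sum_(y < n) g (s - y) = partial_sum g s.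
Proof.
move=> g0; elim: s n => [|s IH] n lesn.
  by rewrite big1 // => i _; rewrite sub0n g0.
case: n lesn => // n lesn.
by rewrite big_ord_recl subn0 addnC /= -(IH n).
Qed.

Lemma count_below n s : s <= n ->
  \sum_(w < n) ((odd w == odd s) && (w < s)) = s./2.
Proof.
(* The induction on [n] passes through [n <= s], where the bound [w < s] is not yet active. *)
have H : \sum_(w < n) ((odd w == odd s) && (w < s)) =
    if n <= s then (n + ~~ odd s)./2 else s./2.
  elim: n => [|n IH]; first by rewrite big_ord0; case: (odd s).
  by rewrite big_ord_recr IH /=; do ! case: ifP => ?; lia.
by move=> les; rewrite {}H; case: ifP => ?; lia.
Qed.

Lemma count_between n a b : odd a = odd b ->
  \sum_(w < n) ((odd w == odd b) && (a < w < b)) <= (b - a).-1./2.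
Proof.
move=> par.
have H : \sum_(w < n) ((odd w == odd b) && (a < w < b)) =
    if n <= a then 0 else if n <= b then (n - a).-1./2 else (b - a).-1./2.
  elim: n => [|n IH]; first by rewrite big_ord0.
  by rewrite big_ord_recr IH /=; do ! case: ifP => ?; lia.
by rewrite {}H; do ! case: ifP => ?; lia.
Qed.

(* The number of points of the cube at a distance from a corner that is less than [s]
   and of the parity of [s]. *)
Definition corner_size (s : nat) : nat := partial_sum (partial_sum half) s.

(* The number of points in which the cuts at the two ends of an edge overlap, if the
   sum of their depths exceeds the length of the edge by [2 * e]. *)
Definition edge_size (e : nat) : nat := partial_sum (partial_sum id) e.-1.

(** The inner sum is [t^2 / 4] and the outer one a cubic, up to parity corrections; these stay on
    the left to avoid subtraction. *)
Lemma corner_sizeE s : 24 * corner_size s + 3 * odd s + 2 * s = 2 * s ^ 3 + 3 * s ^ 2.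
Proof.
have H t : 4 * partial_sum half t + odd t = t ^ 2.
  elim: t => //= t IH.
  have -> : t.+1 ^ 2 = t ^ 2 + 2 * t + 1 by rewrite !expnS !expn0; nia.
  by lia.
rewrite /corner_size; elim: s => //= s IH.
have := H s.+1; rewrite /= => H1.
have -> : 2 * s.+1 ^ 3 + 3 * s.+1 ^ 2 = 2 * s ^ 3 + 3 * s ^ 2 + 6 * s ^ 2 + 12 * s + 5.
  by rewrite !expnS !expn0; nia.
have E : s.+1 ^ 2 = s ^ 2 + 2 * s + 1 by rewrite !expnS !expn0; nia.
by lia.
Qed.

(** These are the tetrahedral numbers, the binomial coefficients of [e + 1] over [3]. *)
Lemma edge_sizeE e : 6 * edge_size e + e = e ^ 3.
Proof.
case: e => [|e]; rewrite /edge_size /=; first by [].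
have H t : 2 * partial_sum id t = t ^ 2 + t.
  by elim: t => //= t IH; rewrite !expnS !expn0; nia.
elim: e => //= e IH.
have := H e.+1; rewrite /= !expnS !expn0 in IH * => H1; nia.
Qed.

Lemma leq_bool (b b' : bool) : (b -> b') -> b <= b'.
Proof. by case: b => // ->. Qed.

(** A reflection moves the corner to the origin. As [s <= D], the cut does not reach beyond the
    cube, and fixed [x], [y] leave half of [s - x - y] values of [w]. *)
Lemma corner_count D a b c s : s <= D ->
  cube_sum D (fun x y w => (odd (corner_dist D a b c x y w) == odd s) &&
                           (corner_dist D a b c x y w < s)) = corner_size s.
Proof.
move=> lesD; rewrite (cube_sum_flip D a b c).
rewrite (eq_cube_sum (g := fun x y w =>
   (odd w == odd (s - x - y)) && (w < s - x - y))); last first.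
  by move=> x y w lex ley lew; rewrite /corner_dist !flipK //; lia.
rewrite /corner_size -(@sum_sub_partial _ D.+1) //; last by lia.
apply: eq_bigr => x _; rewrite -(@sum_sub_partial _ D.+1) //; last by lia.
by apply: eq_bigr => y _; rewrite count_below //; lia.
Qed.

(** After reflection the overlap requires [x + y + D - s' < w < s - x - y]. With
    [s + s' = D + 2 * e], at most [e - x - y - 1] values of [w] have the right parity; for
    [s + s' <= D] there are none. *)
Lemma edge_count_axis3 D a b c s s' : s <= D -> s' <= D -> odd s' = odd (D + s) ->
  cube_sum D (fun x y w => (odd (corner_dist D a b c x y w) == odd s) &&
     (corner_dist D a b c x y w < s) && (corner_dist D a b (~~ c) x y w < s'))
  <= edge_size (s + s' - D)./2.
Proof.
move=> les les' par; rewrite (cube_sum_flip D a b c).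
have [le_D|lt_D] := leqP (s + s') D.
  rewrite /cube_sum big1 // => x _; rewrite big1 // => y _; rewrite big1 // => w _.
  have lew : w <= D by rewrite -ltnS.
  rewrite /corner_dist flip_flipC // !flipK -1?ltnS //; apply/eqP; rewrite eqb0.
  by apply/negP => /andP[/andP[_ lt_s] lt_s']; clear - le_D lew lt_s lt_s'; lia.
have [e E] : exists e, s + s' = D + e.*2.
  exists (s + s' - D)./2; rewrite even_halfK ?subnKC 1?ltnW //.
  by rewrite oddB 1?ltnW // oddD par oddD; case: (odd s); case: (odd D).
have -> : (s + s' - D)./2 = e by rewrite E addKn doubleK.
rewrite /edge_size -(@sum_sub_partial _ D.+1) //; last by clear - les les' E; lia.
apply: leq_sum => x _; rewrite -(@sum_sub_partial _ D.+1) //; last by clear - les les' E; lia.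
apply: leq_sum => y _.
have [h|h] := leqP s (x + y).
  rewrite big1 // => w _; rewrite /corner_dist !flipK -1?ltnS //; apply/eqP; rewrite eqb0.
  by apply/negP => /andP[/andP[_ lt_s] _]; clear - h lt_s; lia.
have le_s' : s' <= x + y + D by clear - les'; lia.
have le_xy : x <= s /\ y <= s - x by clear - h; lia.
have par_xy : odd (x + y + D - s') = odd (s - x - y).
  rewrite oddB // par !oddB ?oddD; try by case: le_xy.
  by case: (odd x); case: (odd y); case: (odd D); case: (odd s).
apply: leq_trans (leq_trans (count_between D.+1 par_xy) _); last first.
  have -> : s - x - y - (x + y + D - s') = (e - x - y).*2 by clear - E h le_s'; lia.
  have half_pred k : k.*2.-1./2 = k.-1 by case: k => // k; rewrite doubleS /= uphalf_double.
  by rewrite half_pred; clear; lia.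
apply: leq_sum => w _.
have lew : w <= D by rewrite -ltnS.
rewrite /corner_dist flip_flipC // !flipK -1?ltnS //; apply: leq_bool.
move=> /andP[/andP[/eqP par_w lt_s] lt_s']; rewrite !oddB -?par_w ?oddD; try by case: le_xy.
rewrite [X in X && _](_ : _ = true); last by case: (odd x); case: (odd y); case: (odd w).
by clear - lew le_s' lt_s lt_s'; rewrite andTb; apply/andP; split; lia.
Qed.

Lemma edge_count_axis2 D a b c s s' : s <= D -> s' <= D -> odd s' = odd (D + s) ->
  cube_sum D (fun x y w => (odd (corner_dist D a b c x y w) == odd s) &&
     (corner_dist D a b c x y w < s) && (corner_dist D a (~~ b) c x y w < s'))
  <= edge_size (s + s' - D)./2.
Proof.
move=> les les' par; rewrite cube_sum_swap23.
apply: leq_trans (edge_count_axis3 a c b les les' par).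
by apply: leq_cube_sum => x y w _ _ _; rewrite /corner_dist !(addnAC _ (flip D _ w)).
Qed.

Lemma edge_count_axis1 D a b c s s' : s <= D -> s' <= D -> odd s' = odd (D + s) ->
  cube_sum D (fun x y w => (odd (corner_dist D a b c x y w) == odd s) &&
     (corner_dist D a b c x y w < s) && (corner_dist D (~~ a) b c x y w < s'))
  <= edge_size (s + s' - D)./2.
Proof.
move=> les les' par; rewrite cube_sum_swap12.
apply: leq_trans (edge_count_axis2 b a c les les' par).
by apply: leq_cube_sum => x y w _ _ _; rewrite /corner_dist !(addnC (flip D _ y)).
Qed.

(* [s1], ..., [s4] are the depths of the cuts at the corners with an even number of
   flipped coordinates; the cut opposite to the one of depth [si] has depth [D - si]. *)
Definition in_cut_cube (D : nat) (t : bool) (s1 s2 s3 s4 x y w : nat) : bool :=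
  [&& odd (x + y + w) == t,
      s1 <= corner_dist D false false false x y w,
      s2 <= corner_dist D true true false x y w,
      s3 <= corner_dist D true false true x y w,
      s4 <= corner_dist D false true true x y w,
      D - s1 <= corner_dist D true true true x y w,
      D - s2 <= corner_dist D false false true x y w,
      D - s3 <= corner_dist D false true false x y w &
      D - s4 <= corner_dist D true false false x y w].

Definition cut_cube_size D t s1 s2 s3 s4 : nat :=
  cube_sum D (in_cut_cube D t s1 s2 s3 s4).

Definition parity_cube_size (D : nat) (t : bool) : nat :=
  cube_sum D (fun x y w => odd (x + y + w) == t).

Definition corner_pair_size (D s : nat) : nat := corner_size s + corner_size (D - s).

(** On the edge from a corner of depth [s] to one of depth [D - s'], the depths exceed the length
    [D] by [s - s']; on the opposite edge by [s' - s]. At most one of these truncated differences is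
    nonzero. *)
Definition edge_pair_size (s s' : nat) : nat :=
  edge_size (s - s')./2 + edge_size (s' - s)./2.

(** * Inclusion-exclusion over corners and edges *)

Lemma odd_corner_dist D a b c x y w : x <= D -> y <= D -> w <= D ->
  odd (corner_dist D a b c x y w) = odd (x + y + w) (+) (a (+) b (+) c) && odd D.
Proof.
move=> lex ley lew; rewrite /corner_dist.
by case: a; case: b; case: c => /=; lia.
Qed.

(** Union bound: a point of the cube of parity [t] is in the cut cube or in one of the eight
    cuts. *)
Lemma cut_cube_lower D s1 s2 s3 s4 t :
  s1 <= D -> s2 <= D -> s3 <= D -> s4 <= D ->
  odd s1 = t -> odd s2 = t -> odd s3 = t -> odd s4 = t ->
  parity_cube_size D t <= cut_cube_size D t s1 s2 s3 s4 +
    (corner_pair_size D s1 + corner_pair_size D s2 +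
     corner_pair_size D s3 + corner_pair_size D s4).
Proof.
move=> le1 le2 le3 le4 o1 o2 o3 o4.
rewrite /corner_pair_size.
rewrite -(corner_count false false false le1) -(corner_count true true false le2).
rewrite -(corner_count true false true le3) -(corner_count false true true le4).
rewrite -(corner_count true true true (leq_subr s1 D)).
rewrite -(corner_count false false true (leq_subr s2 D)).
rewrite -(corner_count false true false (leq_subr s3 D)).
rewrite -(corner_count true false false (leq_subr s4 D)).
rewrite /parity_cube_size /cut_cube_size !cube_sumD.
apply: leq_cube_sum => x y w lex ley lew.
rewrite !odd_corner_dist // !oddB // o1 o2 o3 o4 /in_cut_cube.
rewrite !(ltnNge (corner_dist _ _ _ _ _ _ _)).
case: (odd (x + y + w)); case: t {o1 o2 o3 o4}; case: (odd D) => //=.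
all: by do 8 (case: (_ <= corner_dist _ _ _ _ _ _ _) => //=).
Qed.

(** The second Bonferroni inequality for eight events, of which only the pairs [ai], [bj] with
    distinct [i], [j] can occur together. These are the pairs of corners joined by an edge. *)
Lemma bonferroni8 (a1 a2 a3 a4 b1 b2 b3 b4 : bool) :
  ~~ [|| a1 && a2, a1 && a3, a1 && a4, a2 && a3, a2 && a4 | a3 && a4] ->
  ~~ [|| b1 && b2, b1 && b3, b1 && b4, b2 && b3, b2 && b4 | b3 && b4] ->
  ~~ [|| a1 && b1, a2 && b2, a3 && b3 | a4 && b4] ->
  [&& ~~ a1, ~~ a2, ~~ a3, ~~ a4, ~~ b1, ~~ b2, ~~ b3 & ~~ b4] +
    (a1 + b1 + (a2 + b2) + (a3 + b3) + (a4 + b4)) <=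
  1 + (((a1 && b2) + (a2 && b1)) + ((a1 && b3) + (a3 && b1)) +
       ((a1 && b4) + (a4 && b1)) + ((a2 && b3) + (a3 && b2)) +
       ((a2 && b4) + (a4 && b2)) + ((a3 && b4) + (a4 && b3))).
Proof.
by move: a1 a2 a3 a4 b1 b2 b3 b4 => [] [] [] [] [] [] [] [].
Qed.

Lemma cut_cube_upper D s1 s2 s3 s4 t :
  s1 <= D -> s2 <= D -> s3 <= D -> s4 <= D ->
  odd s1 = t -> odd s2 = t -> odd s3 = t -> odd s4 = t ->
  cut_cube_size D t s1 s2 s3 s4 +
    (corner_pair_size D s1 + corner_pair_size D s2 +
     corner_pair_size D s3 + corner_pair_size D s4) <=
  parity_cube_size D t +
    (edge_pair_size s1 s2 + edge_pair_size s1 s3 + edge_pair_size s1 s4 +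
     edge_pair_size s2 s3 + edge_pair_size s2 s4 + edge_pair_size s3 s4).
Proof.
move=> le1 le2 le3 le4 o1 o2 o3 o4.
have par i j : i <= D -> j <= D -> odd i = t -> odd j = t -> odd (D - j) = odd (D + i).
  by lia.
have half_sub i j : j <= D -> (i - j)./2 = (i + (D - j) - D)./2 by lia.
rewrite /corner_pair_size /edge_pair_size.
rewrite -(corner_count false false false le1) -(corner_count true true false le2).
rewrite -(corner_count true false true le3) -(corner_count false true true le4).
rewrite -(corner_count true true true (leq_subr s1 D)).
rewrite -(corner_count false false true (leq_subr s2 D)).
rewrite -(corner_count false true false (leq_subr s3 D)).
rewrite -(corner_count true false false (leq_subr s4 D)).
have H12 := edge_count_axis3 false false false le1 (leq_subr s2 D) (par _ _ le1 le2 o1 o2).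
have H13 := edge_count_axis2 false false false le1 (leq_subr s3 D) (par _ _ le1 le3 o1 o3).
have H14 := edge_count_axis1 false false false le1 (leq_subr s4 D) (par _ _ le1 le4 o1 o4).
have H21 := edge_count_axis3 true true false le2 (leq_subr s1 D) (par _ _ le2 le1 o2 o1).
have H23 := edge_count_axis1 true true false le2 (leq_subr s3 D) (par _ _ le2 le3 o2 o3).
have H24 := edge_count_axis2 true true false le2 (leq_subr s4 D) (par _ _ le2 le4 o2 o4).
have H31 := edge_count_axis2 true false true le3 (leq_subr s1 D) (par _ _ le3 le1 o3 o1).
have H32 := edge_count_axis1 true false true le3 (leq_subr s2 D) (par _ _ le3 le2 o3 o2).
have H34 := edge_count_axis3 true false true le3 (leq_subr s4 D) (par _ _ le3 le4 o3 o4).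
have H41 := edge_count_axis1 false true true le4 (leq_subr s1 D) (par _ _ le4 le1 o4 o1).
have H42 := edge_count_axis2 false true true le4 (leq_subr s2 D) (par _ _ le4 le2 o4 o2).
have H43 := edge_count_axis3 false true true le4 (leq_subr s3 D) (par _ _ le4 le3 o4 o3).
rewrite (half_sub s1 s2 le2) (half_sub s1 s3 le3) (half_sub s1 s4 le4)
  (half_sub s2 s1 le1) (half_sub s2 s3 le3) (half_sub s2 s4 le4).
rewrite (half_sub s3 s1 le1) (half_sub s3 s2 le2) (half_sub s3 s4 le4)
  (half_sub s4 s1 le1) (half_sub s4 s2 le2) (half_sub s4 s3 le3).
have {H12 H21} H12 := leq_add H12 H21.
have {H13 H31} H13 := leq_add H13 H31.
have {H14 H41} H14 := leq_add H14 H41.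
have {H23 H32} H23 := leq_add H23 H32.
have {H24 H42} H24 := leq_add H24 H42.
have {H34 H43} H34 := leq_add H34 H43.
have H := leq_add (leq_add (leq_add (leq_add (leq_add H12 H13) H14) H23) H24) H34.
apply: leq_trans (leq_add (leqnn _) H) => {H12 H13 H14 H23 H24 H34 H}.
rewrite /parity_cube_size /cut_cube_size !cube_sumD.
apply: leq_cube_sum => x y w lex ley lew.
rewrite !odd_corner_dist // !oddB // o1 o2 o3 o4 /in_cut_cube.
have E i a b c : (i <= corner_dist D a b c x y w) = ~~ (corner_dist D a b c x y w < i).
  by rewrite -leqNgt.
rewrite !E.
have [->|ne] := eqVneq (odd (x + y + w)) t; last first.
  by case: (odd (x + y + w)) ne; case: t {par o1 o2 o3 o4}; case: (odd D).
have -> : (t (+) odd D == odd D (+) t) by case: t {par o1 o2 o3 o4}; case: (odd D).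
rewrite /= ?andbF ?addbF ?eqxx /=.
have F b : (b == b (+) false) by case: b.
have G : t (+) odd D == odd D (+) t by case: t {par o1 o2 o3 o4}; case: (odd D).
rewrite ?F ?G /=.
(* Two corners that differ in at least two coordinates are at distance at least [2 * D], so cuts of
   depth at most [D] there are disjoint. *)
have excl i j (u v : nat) : i <= D -> j <= D -> 2 * D <= u + v -> ~~ ((u < i) && (v < j)).
  by move=> lei lej le_uv; apply/negP => /andP[lt_u lt_v]; lia.
clear E F G par half_sub o1 o2 o3 o4.
by apply: bonferroni8; rewrite !negb_or;
  do ! (apply/andP; split); apply: excl; rewrite ?leq_subr // /corner_dist /=; lia.
Qed.

(** * The optimal depths of the cuts *)

Lemma sum_odd (f : bool -> nat) n :
  \sum_(w < n) f (odd w) = uphalf n * f false + n./2 * f true.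
Proof.
elim: n => [|n IH]; first by rewrite big_ord0.
rewrite big_ord_recr {}IH /= uphalf_half.
by case: (odd n) => /=; lia.
Qed.

(** [p] and [m] count the even and the odd values in [[0, D]]; an odd sum has one or three odd
    terms, an even sum none or two. *)
Lemma parity_cube_sizeE D t : let p := uphalf D.+1 in let m := D.+1./2 in
  parity_cube_size D t =
    if t then 3 * p ^ 2 * m + m ^ 3 else p ^ 3 + 3 * p * m ^ 2.
Proof.
move=> p m; rewrite /parity_cube_size /cube_sum.
have H1 b : \sum_(w < D.+1) (b (+) odd w == t) = if b (+) t then m else p.
  rewrite (sum_odd (fun c => b (+) c == t)) -/p -/m.
  by case: b; case: (t) => /=; lia.
have H2 b : \sum_(y < D.+1) \sum_(w < D.+1) (b (+) odd y (+) odd w == t) =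
    if b (+) t then 2 * (p * m) else p ^ 2 + m ^ 2.
  under eq_bigr do rewrite H1.
  rewrite (sum_odd (fun c => if b (+) c (+) t then m else p)) -/p -/m.
  by case: b; case: (t) => /=; lia.
under eq_bigr => x _ do under eq_bigr => y _ do under eq_bigr => w _ do
  rewrite !oddD.
under eq_bigr do rewrite H2.
rewrite (sum_odd (fun c => if c (+) t then 2 * (p * m) else p ^ 2 + m ^ 2)) -/p -/m.
by case: (t) => /=; rewrite !expnS !expn0; nia.
Qed.

(** The two classes differ by [(p - m)^3], and [p = m + 1] for even [D]. *)
Lemma parity_cube_size_even D t t' : ~~ odd D ->
  parity_cube_size D t <= parity_cube_size D t' + 1.
Proof.
move=> evD; rewrite !parity_cube_sizeE.
have -> : uphalf D.+1 = (D.+1./2).+1 by lia.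
by case: t; case: t'; rewrite !expnS !expn0; nia.
Qed.

Lemma parity_cube_size_odd D t t' : odd D ->
  parity_cube_size D t = parity_cube_size D t'.
Proof.
move=> oddD; rewrite !parity_cube_sizeE.
have -> : uphalf D.+1 = D.+1./2 by lia.
by case: t; case: t'; rewrite !expnS !expn0; nia.
Qed.

Lemma corner_pair_size_sym D s : s <= D -> corner_pair_size D (D - s) = corner_pair_size D s.
Proof. by move=> les; rewrite /corner_pair_size subKn // addnC. Qed.

Lemma corner_pair_size_even Q x : x <= Q ->
  24 * corner_pair_size Q.*2 (Q + x) + 6 * odd (Q + x) =
  24 * corner_pair_size Q.*2 Q + 6 * odd Q + 6 * (Q.*2 + 1) * x ^ 2.
Proof.
move=> lexQ; rewrite /corner_pair_size.
have [y ->] : exists y, Q = x + y by exists (Q - x); lia.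
have -> : (x + y).*2 - (x + y + x) = y by lia.
have -> : (x + y).*2 - (x + y) = x + y by lia.
have := corner_sizeE y; have := corner_sizeE (x + y); have := corner_sizeE (x + y + x).
have -> : odd (x + y + x) = odd y by lia.
rewrite !expnS !expn0; lia.
Qed.

Lemma corner_pair_size_odd Q x : x <= Q ->
  24 * corner_pair_size Q.*2.+1 (Q.+1 + x) =
  24 * corner_pair_size Q.*2.+1 Q + 6 * (Q.*2 + 2) * (x ^ 2 + x).
Proof.
move=> lexQ; rewrite /corner_pair_size.
have [y ->] : exists y, Q = x + y by exists (Q - x); lia.
have -> : (x + y).*2.+1 - ((x + y).+1 + x) = y by lia.
have -> : (x + y).*2.+1 - (x + y) = (x + y).+1 by lia.
have := corner_sizeE y; have := corner_sizeE (x + y); have := corner_sizeE (x + y).+1.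
have := corner_sizeE ((x + y).+1 + x).
have -> : odd ((x + y).+1 + x) = ~~ odd y by lia.
have -> : odd (x + y).+1 = ~~ odd (x + y) by lia.
rewrite !expnS !expn0; case: (odd y); case: (odd (x + y)) => /=; lia.
Qed.

Lemma edge_size_le D e : e.*2 <= D -> 12 * edge_size e <= D * e ^ 2.
Proof.
move=> leD; have := edge_sizeE e.
have : e.*2 * e ^ 2 <= D * e ^ 2 by rewrite leq_mul2r leD orbT.
rewrite !expnS !expn0; lia.
Qed.

Lemma edge_pair_size_le D s s' : s <= D -> s' <= D -> odd s = odd s' ->
  48 * edge_pair_size s s' <= D * ((s - s') ^ 2 + (s' - s) ^ 2).
Proof.
wlog le_s : s s' / s' <= s => [H les les' par|les les' par].
  have [/H|/ltnW/H] := leqP s' s; first exact.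
  by rewrite /edge_pair_size addnC [(s' - s) ^ 2 + _]addnC; apply.
rewrite /edge_pair_size.
have [e E] : exists e, s = s' + e.*2 by exists (s - s')./2; lia.
have -> : (s - s')./2 = e by lia.
have -> : (s' - s)./2 = 0 by lia.
have -> : s' - s = 0 by lia.
have -> : s - s' = e.*2 by lia.
have := @edge_size_le D e ltac:(lia).
have -> : edge_size 0 = 0 by [].
by rewrite !expnS !expn0; lia.
Qed.

Lemma sqr_distn_le2 e x x' : e <= x + x' -> e ^ 2 <= 2 * (x ^ 2 + x' ^ 2).
Proof.
rewrite -leq_sqr => /leq_trans-> //; rewrite sqrnD.
by have [h _] := nat_Cauchy x x'; lia.
Qed.

(** The bound fails for [e = 1] and [x = x' = 0]. The second hypothesis excludes this; it holds for
    depths because two depths of equal parity in [{Q, Q + 1}] coincide. *)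
Lemma sqr_distn_le4 e x x' : e <= x + x' + 1 -> (0 < e -> 0 < x + x') ->
  e ^ 2 <= 4 * (x ^ 2 + x + (x' ^ 2 + x')).
Proof.
case: (posnP e) => [->|_]; first by rewrite exp0n.
rewrite -leq_sqr => le_e /(_ isT) pos; apply: leq_trans le_e _.
by have [h _] := nat_Cauchy x x'; rewrite !sqrnD; lia.
Qed.

Lemma sqrn_dist i j : (i - j) ^ 2 + (j - i) ^ 2 = ((i - j) + (j - i)) ^ 2.
Proof.
by case: (leqP i j) => [|/ltnW]; rewrite -subn_eq0 => /eqP->; rewrite exp0n // ?addn0.
Qed.

Lemma edge_pair_size_even Q s s' x x' : s <= Q.*2 -> s' <= Q.*2 -> odd s = odd s' ->
  (s = Q + x \/ s + x = Q) -> (s' = Q + x' \/ s' + x' = Q) ->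
  24 * edge_pair_size s s' <= Q.*2 * (x ^ 2 + x' ^ 2).
Proof.
move=> les les' par dx dx'; have h1 := edge_pair_size_le les les' par.
have h2 : (s - s') + (s' - s) <= x + x' by clear - dx dx'; lia.
move: h1; rewrite sqrn_dist => /leq_trans/(_ (leq_mul (leqnn _) (sqr_distn_le2 h2))).
by rewrite -[48]/(2 * 24) mulnCA -mulnA leq_pmul2l.
Qed.

Lemma edge_pair_size_odd Q s s' x x' : s <= Q.*2.+1 -> s' <= Q.*2.+1 -> odd s = odd s' ->
  (s = Q.+1 + x \/ s + x = Q) -> (s' = Q.+1 + x' \/ s' + x' = Q) ->
  12 * edge_pair_size s s' <= Q.*2.+1 * (x ^ 2 + x + (x' ^ 2 + x')).
Proof.
move=> les les' par dx dx'; have h1 := edge_pair_size_le les les' par.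
have h2 : (s - s') + (s' - s) <= x + x' + 1 by clear - dx dx'; lia.
have h3 : 0 < (s - s') + (s' - s) -> 0 < x + x' by clear - par dx dx'; lia.
move: h1; rewrite sqrn_dist => /leq_trans/(_ (leq_mul (leqnn _) (sqr_distn_le4 h2 h3))).
by rewrite -[48]/(4 * 12) mulnCA -mulnA leq_pmul2l.
Qed.

Lemma corner_pair_size_dev_even Q s : s <= Q.*2 ->
  exists x, (s = Q + x \/ s + x = Q) /\
    24 * corner_pair_size Q.*2 s + 6 * odd s =
    24 * corner_pair_size Q.*2 Q + 6 * odd Q + 6 * (Q.*2 + 1) * x ^ 2.
Proof.
move=> les; have [leQs|leQs] := leqP Q s.
  exists (s - Q); split; first by lia.
  by rewrite -corner_pair_size_even ?subnKC //; lia.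
exists (Q - s); split; first by lia.
rewrite -corner_pair_size_even ?leq_subr //.
have -> : Q + (Q - s) = Q.*2 - s by lia.
by rewrite corner_pair_size_sym // oddB // odd_double.
Qed.

Lemma corner_pair_size_dev_odd Q s : s <= Q.*2.+1 ->
  exists x, (s = Q.+1 + x \/ s + x = Q) /\
    24 * corner_pair_size Q.*2.+1 s =
    24 * corner_pair_size Q.*2.+1 Q + 6 * (Q.*2 + 2) * (x ^ 2 + x).
Proof.
move=> les; have [leQs|leQs] := ltnP Q s.
  exists (s - Q.+1); split; first by lia.
  by rewrite -corner_pair_size_odd ?subnKC //; lia.
exists (Q - s); split; first by lia.
rewrite -corner_pair_size_odd ?leq_subr //.
have -> : Q.+1 + (Q - s) = Q.*2.+1 - s by lia.
by rewrite corner_pair_size_sym.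
Qed.

(** Each depth lies in three of the six pairs. For [D = 2 * Q], and up to the factor [24], the edges
    thus regain at most [6 * Q] times the sum of the squared deviations, while the corners lose
    [6 * (2 * Q + 1)] times that sum. Odd [D] is similar, with [x^2 + x] for [x^2]. *)
Lemma cut_cube_size_max D t s1 s2 s3 s4 :
  s1 <= D -> s2 <= D -> s3 <= D -> s4 <= D ->
  odd s1 = t -> odd s2 = t -> odd s3 = t -> odd s4 = t ->
  cut_cube_size D t s1 s2 s3 s4 <=
    cut_cube_size D (odd D./2) D./2 D./2 D./2 D./2.
Proof.
move Q_eq : D./2 => Q le1 le2 le3 le4 o1 o2 o3 o4.
have DE : D = odd D + Q.*2 by rewrite -Q_eq odd_double_half.
have leQ : Q <= D by clear - DE; lia.
have low := cut_cube_lower leQ leQ leQ leQ erefl erefl erefl erefl.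
have up := cut_cube_upper le1 le2 le3 le4 o1 o2 o3 o4.
have o12 := etrans o1 (esym o2); have o13 := etrans o1 (esym o3).
have o14 := etrans o1 (esym o4); have o23 := etrans o2 (esym o3).
have o24 := etrans o2 (esym o4); have o34 := etrans o3 (esym o4).
have [oddD|evD] := boolP (odd D).
- rewrite oddD add1n in DE; rewrite {}DE in le1 le2 le3 le4 low up oddD *.
  have [x1 [d1 c1]] := corner_pair_size_dev_odd le1.
  have [x2 [d2 c2]] := corner_pair_size_dev_odd le2.
  have [x3 [d3 c3]] := corner_pair_size_dev_odd le3.
  have [x4 [d4 c4]] := corner_pair_size_dev_odd le4.
  have e12 := edge_pair_size_odd le1 le2 o12 d1 d2.
  have e13 := edge_pair_size_odd le1 le3 o13 d1 d3.
  have e14 := edge_pair_size_odd le1 le4 o14 d1 d4.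
  have e23 := edge_pair_size_odd le2 le3 o23 d2 d3.
  have e24 := edge_pair_size_odd le2 le4 o24 d2 d4.
  have e34 := edge_pair_size_odd le3 le4 o34 d3 d4.
  move: low up; rewrite (parity_cube_size_odd t (odd Q) oddD).
  move: (x1 ^ 2 + x1) (x2 ^ 2 + x2) (x3 ^ 2 + x3) (x4 ^ 2 + x4)
    c1 c2 c3 c4 e12 e13 e14 e23 e24 e34 => y1 y2 y3 y4.
  clear; lia.
- rewrite (negbTE evD) add0n in DE; rewrite {}DE in le1 le2 le3 le4 low up evD *.
  have [x1 [d1 c1]] := corner_pair_size_dev_even le1.
  have [x2 [d2 c2]] := corner_pair_size_dev_even le2.
  have [x3 [d3 c3]] := corner_pair_size_dev_even le3.
  have [x4 [d4 c4]] := corner_pair_size_dev_even le4.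
  have e12 := edge_pair_size_even le1 le2 o12 d1 d2.
  have e13 := edge_pair_size_even le1 le3 o13 d1 d3.
  have e14 := edge_pair_size_even le1 le4 o14 d1 d4.
  have e23 := edge_pair_size_even le2 le3 o23 d2 d3.
  have e24 := edge_pair_size_even le2 le4 o24 d2 d4.
  have e34 := edge_pair_size_even le3 le4 o34 d3 d4.
  rewrite o1 in c1; rewrite o2 in c2; rewrite o3 in c3; rewrite o4 in c4.
  have [tQ|tQ] := eqVneq t (odd Q).
    move: low up c1 c2 c3 c4; rewrite {}tQ.
    move: (x1 ^ 2) (x2 ^ 2) (x3 ^ 2) (x4 ^ 2) e12 e13 e14 e23 e24 e34.
    clear; move=> y1 y2 y3 y4; lia.
  (* In the other parity class the four deviations are nonzero. The surplus, at least
     [4 * (6 * Q + 6) >= 48], pays for the [24] from the one possible extra point and the [24] from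
     the parity terms. *)
  have box := parity_cube_size_even t (odd Q) evD.
  have pos s x : odd s = t -> (s = Q + x \/ s + x = Q) -> 0 < x ^ 2.
    move=> os d; rewrite expn_gt0 orbF lt0n; apply: contra_neqN tQ => /eqP x0.
    by rewrite -os; case: d; rewrite x0 addn0 => ->.
  have Q_gt0 : 0 < Q.
    by rewrite lt0n; apply: contraNneq tQ => Q0; move: le1 o1; rewrite Q0 leqn0 => /eqP-> <-.
  move: low up c1 c2 c3 c4 box (pos _ _ o1 d1) (pos _ _ o2 d2) (pos _ _ o3 d3)
    (pos _ _ o4 d4) e12 e13 e14 e23 e24 e34.
  move: (x1 ^ 2) (x2 ^ 2) (x3 ^ 2) (x4 ^ 2) => y1 y2 y3 y4.
  have : 12 * (y1 + y2 + y3 + y4) <= (6 * Q + 6) * (y1 + y2 + y3 + y4).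
    by rewrite leq_mul2r; apply/orP; right; clear - Q_gt0; lia.
  have : odd Q + t = 1 by case: (odd Q) (t) tQ => [] [].
  clear; lia.
Qed.

(** * From anticodes to cut cubes *)

Lemma cube_sum_card D (P : nat -> nat -> nat -> bool) :
  cube_sum D P = #|[set p : 'I_D.+1 * 'I_D.+1 * 'I_D.+1 | P p.1.1 p.1.2 p.2]|.
Proof.
rewrite -sum1_card /cube_sum pair_big pair_big /= [RHS]big_mkcond /=.
by apply: eq_bigr => -[[x y] w] _; rewrite inE /=; case: (P x y w).
Qed.

Lemma ex_argmin k (f : 'I_k.+1 -> int) : exists i0, forall i, (f i0 <= f i)%R.
Proof.
have [i _ Hi] := arg_minP f (isT : (fun=> true) (ord0 : 'I_k.+1)).
by exists i => j; apply: Hi.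
Qed.

(* A lower cutting depth beyond [D] is lowered to the largest admissible depth of
   the right parity. *)
Lemma ex_slab D k (t : bool) (f : 'I_k.+1 -> nat) :
  (forall i, odd (f i) = t) -> (forall i, f i <= 3 * D) ->
  (forall i j, f i <= f j + 2 * D) ->
  exists s, [/\ s <= D, odd s = t & forall i, s <= f i <= s + 2 * D].
Proof.
move=> par le3 diam; have [i0 min_i0] := ex_argmin (fun i => Posz (f i)).
have {}min_i0 i : f i0 <= f i by have := min_i0 i; lia.
have [leD|ltD] := leqP (f i0) D.
  by exists (f i0); split=> // i; rewrite min_i0 diam.
(* For the depth [D - 1] the upper bound is [3 * D - 1], and the value [3 * D] has the wrong
   parity. *)
exists (if odd D == t then D else D.-1); case: eqP => [oddD|oddD]; split => //.
- by move=> i; have := min_i0 i; have := le3 i; lia.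
- by lia.
- by have := par i0; have := le3 i0; move: oddD; case: (t); lia.
- move=> i; have := min_i0 i; have := le3 i; have := par i.
  by move: oddD; case: (t); lia.
Qed.

Definition znorm (a b c : int) : int := (`|a| + `|b| + `|c| + `|a + b + c|)%R.

Lemma anticode_bound D k (a b c : 'I_k -> int) :
  injective (fun i => (a i, b i, c i)) ->
  (forall i j, (znorm (a i - a j) (b i - b j) (c i - c j) <= Posz (2 * D))%R) ->
  k <= cut_cube_size D (odd D./2) D./2 D./2 D./2 D./2.
Proof.
case: k a b c => [//|k] a b c inj diam.
(* Subtracting the minima of the pair sums translates the set into [[0, D]^3]. *)
have [i1 m1] := ex_argmin (fun i => (b i + c i)%R).
have [i2 m2] := ex_argmin (fun i => (a i + c i)%R).
have [i3 m3] := ex_argmin (fun i => (a i + b i)%R).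
set b1 := (b i1 + c i1)%R in m1; set b2 := (a i2 + c i2)%R in m2.
set b3 := (a i3 + b i3)%R in m3.
pose X i := `|(b i + c i - b1)%R|%N; pose Y i := `|(a i + c i - b2)%R|%N.
pose W i := `|(a i + b i - b3)%R|%N.
have XE i : (Posz (X i) = b i + c i - b1)%R by rewrite /X; have := m1 i; lia.
have YE i : (Posz (Y i) = a i + c i - b2)%R by rewrite /Y; have := m2 i; lia.
have WE i : (Posz (W i) = a i + b i - b3)%R by rewrite /W; have := m3 i; lia.
have leX i : X i <= D by have := diam i i1; have := XE i; rewrite /znorm /b1; lia.
have leY i : Y i <= D by have := diam i i2; have := YE i; rewrite /znorm /b2; lia.
have leW i : W i <= D by have := diam i i3; have := WE i; rewrite /znorm /b3; lia.
have par i : odd (X i + Y i + W i) = odd `|(b1 + b2 + b3)%R|%N.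
  by have := XE i; have := YE i; have := WE i; lia.
set t := odd _ in par; move: t par => t par.
(* Up to constants, [X + Y + W] is [2 * (a + b + c)], and flipping two coordinates gives [-2 * a],
   [-2 * b] or [-2 * c]. These vary by at most [2 * D]. *)
have slab r1 r2 r3 : r1 (+) r2 (+) r3 = false ->
    exists s, [/\ s <= D, odd s = t & forall i,
      s <= corner_dist D r1 r2 r3 (X i) (Y i) (W i) <= s + 2 * D].
  move=> r123; apply: ex_slab => [i|i|i j].
  - by rewrite odd_corner_dist // r123 addbF.
  - by rewrite /corner_dist; have := flip_le r1 (leX i);
      have := flip_le r2 (leY i); have := flip_le r3 (leW i); lia.
  have := diam i j; have := XE i; have := YE i; have := WE i.
  have := XE j; have := YE j; have := WE j.
  have := leX i; have := leY i; have := leW i; have := leX j; have := leY j; have := leW j.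
  clear - r123; rewrite /corner_dist /znorm; case: r1 r2 r3 r123 => [] [] [] // _ /=; lia.
have [s1 [le1 o1 h1]] := slab false false false erefl.
have [s2 [le2 o2 h2]] := slab true true false erefl.
have [s3 [le3 o3 h3]] := slab true false true erefl.
have [s4 [le4 o4 h4]] := slab false true true erefl.
apply: leq_trans (cut_cube_size_max le1 le2 le3 le4 o1 o2 o3 o4).
rewrite /cut_cube_size cube_sum_card.
pose f i : 'I_D.+1 * 'I_D.+1 * 'I_D.+1 := (inord (X i), inord (Y i), inord (W i)).
have inj_f : injective f.
  move=> i j [/(congr1 val) eX /(congr1 val) eY /(congr1 val) eW]; apply: inj.
  move: eX eY eW; rewrite /= !inordK ?ltnS ?leX ?leY ?leW // => eX eY eW.
  have := XE i; have := YE i; have := WE i; rewrite eX eY eW XE YE WE => *.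
  by congr (_, _, _); lia.
rewrite -[k.+1]card_ord -cardsT -(card_imset _ inj_f).
apply/subset_leq_card/fintype.subsetP => _ /imsetP[i _ ->].
rewrite inE /in_cut_cube /= !inordK ?ltnS ?leX ?leY ?leW // par eqxx /=.
(* Distances to opposite corners add up to [3 * D], so the upper bound [s + 2 * D] is the opposite
   cut of depth [D - s]. *)
have opp r1 r2 r3 : corner_dist D (~~ r1) (~~ r2) (~~ r3) (X i) (Y i) (W i) =
    3 * D - corner_dist D r1 r2 r3 (X i) (Y i) (W i).
  have := leX i; have := leY i; have := leW i.
  by rewrite /corner_dist; case: r1; case: r2; case: r3 => /=; lia.
have := opp false false false; have := opp true true false.
have := opp true false true; have := opp false true true.
move: (h1 i) (h2 i) (h3 i) (h4 i) => /=; clear => *.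
by do ! (apply/andP; split); lia.
Qed.

End CubeCounting.

(** * The root lattice *)

Section RootLattice.
Local Open Scope classical_set_scope.
Local Open Scope card_scope.
Local Open Scope ring_scope.

Definition int_in_anticode (P Q : nat) (a b c : int) : bool :=
  (Num.max a 0 + Num.max b 0 + Num.max c 0 <= P%:Z) &&
  (Num.max (- a) 0 + Num.max (- b) 0 + Num.max (- c) 0 <= Q%:Z).

(* The pair sums [b + c], [a + c], [a + b] of [cube_point Q x y w = (a, b, c)] are
   [x - Q], [y - Q], [w - Q] if [x + y + w] has the parity of [Q]. *)
Definition cube_point (Q x y w : nat) : int * int * int :=
  let h := ((x + y + w + Q)./2)%:Z - Q%:Z in
  (h - x%:Z, h - y%:Z, h - w%:Z).

(** The anticode consists of the points for which all sums over nonempty subsets of the entries lie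
    in [[-Q, P]]. The pair sums give the faces of the cube, the other sums the eight cuts. *)
Lemma cube_point_in_anticode D x y w : (x <= D)%N -> (y <= D)%N -> (w <= D)%N ->
  in_cut_cube D (odd D./2) D./2 D./2 D./2 D./2 x y w ->
  let '(a, b, c) := cube_point D./2 x y w in int_in_anticode (uphalf D) D./2 a b c.
Proof.
move Q_eq : D./2 => Q.
have [DE _] : D = (uphalf D + Q)%N /\ (uphalf D <= Q + 1)%N by lia.
move: (uphalf D) DE => P -> lex ley lew {Q_eq}.
rewrite /in_cut_cube /corner_dist /=.
case/and5P=> /eqP par h1 h2 h3 /and5P[h4 h5 h6 h7 h8].
have [n E] : exists n, (x + y + w + Q = n.*2)%N by exists (x + y + w + Q)./2; lia.
rewrite E doubleK /int_in_anticode; apply/andP; split; lia.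
Qed.

Lemma cube_point_inj D t s1 s2 s3 s4 x y w x' y' w' Q : odd Q = t ->
  in_cut_cube D t s1 s2 s3 s4 x y w -> in_cut_cube D t s1 s2 s3 s4 x' y' w' ->
  cube_point Q x y w = cube_point Q x' y' w' -> [/\ x = x', y = y' & w = w'].
Proof.
move=> oQ /andP[/eqP par _] /andP[/eqP par' _] [h1 h2 h3].
have [n E] : exists n, (x + y + w + Q = n.*2)%N by exists (x + y + w + Q)./2; lia.
have [n' E'] : exists n, (x' + y' + w' + Q = n.*2)%N
  by exists (x' + y' + w' + Q)./2; lia.
rewrite E E' !doubleK in h1 h2 h3; split; lia.
Qed.

(** * Coordinates on [Z^3] and [A_3] *)

Lemma sum_ord4 (V : nmodType) (F : 'I_4 -> V) :
  \sum_i F i = F (inord 0) + F (inord 1) + F (inord 2) + F (inord 3).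
Proof.
rewrite !big_ord_recl big_ord0 addr0 !addrA.
by congr (_ + _ + _ + _); congr (F _); apply: val_inj; rewrite /= inordK.
Qed.

Lemma sum_ord3 (V : nmodType) (F : 'I_3 -> V) :
  \sum_i F i = F (inord 0) + F (inord 1) + F (inord 2).
Proof.
rewrite !big_ord_recl big_ord0 addr0 !addrA.
by congr (_ + _ + _); congr (F _); apply: val_inj; rewrite /= inordK.
Qed.

Definition row3 (a b c : int) : 'rV[int]_3 := \row_i nth 0 [:: a; b; c] i.

Lemma row3E (x : 'rV[int]_3) : x = row3 (x 0 (inord 0)) (x 0 (inord 1)) (x 0 (inord 2)).
Proof.
apply/rowP=> i; rewrite mxE.
by case: i => [[|[|[|]]]] // lti /=; congr (x 0 _); apply: val_inj; rewrite /= inordK.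
Qed.

Lemma row3D a b c a' b' c' : row3 a b c + row3 a' b' c' = row3 (a + a') (b + b') (c + c').
Proof. by apply/rowP=> -[[|[|[|]]]] // lti; rewrite !mxE. Qed.

Lemma row3B a b c a' b' c' : row3 a b c - row3 a' b' c' = row3 (a - a') (b - b') (c - c').
Proof. by apply/rowP=> -[[|[|[|]]]] // lti; rewrite !mxE. Qed.

Lemma row3_0 : row3 0 0 0 = 0.
Proof. by apply/rowP=> -[[|[|[|]]]] // lti; rewrite !mxE. Qed.

Lemma row3_inj a b c a' b' c' : row3 a b c = row3 a' b' c' ->
  [/\ a = a', b = b' & c = c'].
Proof.
move=> e; split.
- by have := congr1 (fun z : 'rV_3 => z 0 (inord 0)) e; rewrite !mxE inordK.
- by have := congr1 (fun z : 'rV_3 => z 0 (inord 1)) e; rewrite !mxE inordK.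
- by have := congr1 (fun z : 'rV_3 => z 0 (inord 2)) e; rewrite !mxE inordK.
Qed.

Lemma anticodeE P Q a b c : anticode 3 P Q (row3 a b c) <-> int_in_anticode P Q a b c.
Proof.
rewrite /anticode /int_in_anticode /= !sum_ord3 !mxE !inordK //=.
by split=> [[-> ->]|/andP].
Qed.

Definition root_row (a b c : int) : 'rV[int]_4 :=
  \row_i nth 0 [:: a; b; c; - (a + b + c)] i.

Lemma root_rowP a b c : root_row a b c \in @root_pred 3.
Proof. by rewrite unfold_in sum_ord4 !mxE !inordK //= subrr. Qed.

Definition root3 (a b c : int) : root_lattice 3 := RootLattice (root_rowP a b c).

Lemma root3E (z : root_lattice 3) :
  z = root3 (root_val z 0 (inord 0)) (root_val z 0 (inord 1)) (root_val z 0 (inord 2)).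
Proof.
apply: val_inj; apply/rowP=> i; rewrite mxE.
have /eqP := root_valP z; rewrite sum_ord4 => s0.
case: i => [[|[|[|[|]]]]] // lti /=.
- by congr (root_val z 0 _); apply: val_inj; rewrite /= inordK.
- by congr (root_val z 0 _); apply: val_inj; rewrite /= inordK.
- by congr (root_val z 0 _); apply: val_inj; rewrite /= inordK.
apply/eqP; rewrite -addr_eq0 addrC -s0; apply/eqP; congr (_ + root_val z 0 _).
by apply: val_inj; rewrite /= inordK.
Qed.

Lemma root3B a b c a' b' c' :
  root3 a b c - root3 a' b' c' = root3 (a - a') (b - b') (c - c').
Proof.
by apply: val_inj; apply/rowP=> -[[|[|[|[|]]]]] // lti; rewrite !mxE //=; lia.
Qed.

Lemma root3_0 : root3 0 0 0 = 0.
Proof. by apply: val_inj; apply/rowP=> -[[|[|[|[|]]]]] // lti; rewrite !mxE. Qed.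

Lemma root3_inj a b c a' b' c' : root3 a b c = root3 a' b' c' ->
  [/\ a = a', b = b' & c = c'].
Proof.
move=> e; split.
- by have := congr1 (fun z : root_lattice 3 => root_val z 0 (inord 0)) e; rewrite !mxE inordK.
- by have := congr1 (fun z : root_lattice 3 => root_val z 0 (inord 1)) e; rewrite !mxE inordK.
- by have := congr1 (fun z : root_lattice 3 => root_val z 0 (inord 2)) e; rewrite !mxE inordK.
Qed.

Lemma root_distE a b c a' b' c' :
  root_dist (root3 a b c) (root3 a' b' c') = (znorm (a - a') (b - b') (c - c'))%:~R / 2%:R.
Proof.
rewrite /root_dist sum_ord4 !mxE !inordK //= /znorm; congr (_%:~R / _).
by congr (_ + _); lia.
Qed.

Lemma root_dist_le D a b c a' b' c' :
  (root_dist (root3 a b c) (root3 a' b' c') <= D%:R) =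
  (znorm (a - a') (b - b') (c - c') <= (2 * D)%:Z).
Proof.
rewrite root_distE ler_pdivrMr ?ltr0n // -natrM -[(_ * _)%:R]/((Posz (D * 2))%:~R).
by rewrite ler_int mulnC.
Qed.

(** * Neither tilings nor codes for [D >= 3] *)

Lemma no_int_tiling D (L : int -> int -> int -> Prop) : (3 <= D)%N ->
  L 0 0 0 ->
  (forall a b c a' b' c', L a b c -> L a' b' c' -> L (a - a') (b - b') (c - c')) ->
  (forall a b c, L a b c -> znorm a b c <= (2 * D)%:Z -> [/\ a = 0, b = 0 & c = 0]) ->
  (forall a b c, exists a' b' c',
     int_in_anticode (uphalf D) D./2 a' b' c' /\ L (a - a') (b - b') (c - c')) ->
  False.
Proof.
move=> D3 L0 LB pack cov.
(* The search computes in [Z], so the lattice is transported there. *)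
pose LZ (p : tri) := let '(a, b, c) := p in L (int_of_Z a) (int_of_Z b) (int_of_Z c).
apply: (@no_tiling (Z.of_nat (uphalf D)) (Z.of_nat D./2) LZ); [lia | lia | lia |].
split; first exact: L0.
- move=> [[a b] c] [[a' b'] c'] /= Lp Lp'.
  have := LB _ _ _ _ _ _ Lp Lp'.
  by congr (L _ _ _); lia.
- move=> [[a b] c]; rewrite /tnorm => Lp le_p.
  have [|a0 b0 c0] := pack _ _ _ Lp; first by rewrite /znorm; lia.
  by congr (_, _, _); lia.
- move=> [[a b] c].
  have [a' [b' [c' [S L']]]] := cov (int_of_Z a) (int_of_Z b) (int_of_Z c).
  exists (Z_of_int a', Z_of_int b', Z_of_int c'); split.
    move: S; rewrite /int_in_anticode /in_anticode => /andP[h1 h2].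
    by apply: andb_true_intro; split; apply/Z.leb_le; lia.
  by move: L'; rewrite /=; congr (L _ _ _); lia.
Qed.

Lemma truncate_sum3 (P x y w : int) : 0 <= P -> 0 <= x -> 0 <= y -> 0 <= w ->
  exists x1 y1 w1, [/\ 0 <= x1 <= x, 0 <= y1 <= y, 0 <= w1 <= w &
    x1 + y1 + w1 = Num.min P (x + y + w)].
Proof.
move=> P0 x0 y0 w0; have [h1|h1] := lerP P x; first by exists P, 0, 0; split; lia.
have [h2|h2] := lerP P (x + y); first by exists x, (P - x), 0; split; lia.
by exists x, y, (Num.min (P - x - y) w); split; lia.
Qed.

Lemma max_sub_parts (a x1 x2 : int) : 0 <= x1 <= Num.max a 0 -> 0 <= x2 <= Num.max (- a) 0 ->
  [/\ Num.max (x1 - x2) 0 = x1, Num.max (- (x1 - x2)) 0 = x2,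
      Num.max (x1 - x2 - a) 0 = Num.max (- a) 0 - x2 &
      Num.max (- (x1 - x2 - a)) 0 = Num.max a 0 - x1].
Proof. by move=> h1 h2; split; lia. Qed.

(** Take as much of the positive part as [P] allows and of the negative part as [Q] allows. At most
    [Q] of the positive and [P] of the negative part remain, which is the sign pattern of the
    reversed difference. *)
Lemma anticode_split P Q a b c : znorm a b c <= (2 * (P + Q))%:Z ->
  exists a' b' c', int_in_anticode P Q a' b' c' /\
    int_in_anticode P Q (a' - a) (b' - b) (c' - c).
Proof.
move=> le_p.
have le_pos : Num.max a 0 + Num.max b 0 + Num.max c 0 <= (P + Q)%:Z.
  by move: le_p; rewrite /znorm; lia.
have le_neg : Num.max (- a) 0 + Num.max (- b) 0 + Num.max (- c) 0 <= (P + Q)%:Z.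
  by move: le_p; rewrite /znorm; lia.
have ge0 (u : int) : 0 <= Num.max u 0 by lia.
have [a1 [b1 [c1 [ha1 hb1 hc1 e1]]]] :=
  @truncate_sum3 P%:Z _ _ _ isT (ge0 a) (ge0 b) (ge0 c).
have [a2 [b2 [c2 [ha2 hb2 hc2 e2]]]] :=
  @truncate_sum3 Q%:Z _ _ _ isT (ge0 (- a)) (ge0 (- b)) (ge0 (- c)).
exists (a1 - a2), (b1 - b2), (c1 - c2); rewrite /int_in_anticode.
have [-> -> -> ->] := max_sub_parts ha1 ha2.
have [-> -> -> ->] := max_sub_parts hb1 hb2.
have [-> -> -> ->] := max_sub_parts hc1 hc2.
clear - le_pos le_neg e1 e2.
move: (Num.max a 0) (Num.max b 0) (Num.max c 0) (Num.max (- a) 0) (Num.max (- b) 0)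
  (Num.max (- c) 0) le_pos le_neg e1 e2 => p1 p2 p3 n1 n2 n3 *.
by split; apply/andP; split; lia.
Qed.

Lemma tiles_lt3 D : lattice_tiles (anticode_diam 3 D) -> (D < 3)%N.
Proof.
case=> L [[[L0 LB] _] triv cov]; rewrite ltnNge; apply/negP => D3.
apply: (@no_int_tiling D (fun a b c => L (row3 a b c)) D3).
- by rewrite row3_0.
- by move=> a b c a' b' c' Lp Lp'; rewrite -row3B; apply: LB.
- move=> a b c Lp; rewrite {1}(_ : D = uphalf D + D./2)%N; last by lia.
  (* The splitting yields a common point of the translates at [0] and at this vector. *)
  move=> /anticode_split[a' [b' [c' [S1 S2]]]].
  apply: row3_inj; rewrite row3_0; apply: triv => //.
  exists (row3 a' b' c'); split.
    by exists (row3 (a' - a) (b' - b) (c' - c)); [exact/anticodeE | rewrite row3D !subrK].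
  by exists (row3 a' b' c'); [exact/anticodeE | rewrite addr0].
- move=> a b c.
  have : [set: 'rV[int]_3] (row3 a b c) by [].
  rewrite -cov => -[l Ll [s Ss e]]; move: Ll Ss e.
  rewrite (row3E l) (row3E s) row3D.
  move=> Ll /anticodeE Ss /row3_inj[<- <- <-].
  by exists (s 0 (inord 0)), (s 0 (inord 1)), (s 0 (inord 2)); split=> //;
    rewrite ![s 0 _ + _]addrC !addrK.
Qed.

Lemma znorm_le (M a b c : int) :
  Num.max a 0 + Num.max b 0 + Num.max c 0 <= M ->
  Num.max (- a) 0 + Num.max (- b) 0 + Num.max (- c) 0 <= M -> znorm a b c <= 2 * M.
Proof.
have parts (u : int) : u = Num.max u 0 - Num.max (- u) 0 /\
    `|u| = Num.max u 0 + Num.max (- u) 0 by lia.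
rewrite /znorm; have [ea ->] := parts a; have [eb ->] := parts b; have [ec ->] := parts c.
have -> : a + b + c = Num.max a 0 + Num.max b 0 + Num.max c 0 -
    (Num.max (- a) 0 + Num.max (- b) 0 + Num.max (- c) 0) by clear parts; lia.
have ge0 (u : int) : 0 <= Num.max u 0 by lia.
have := (ge0 a, ge0 b, ge0 c, ge0 (- a), ge0 (- b), ge0 (- c)).
move: (Num.max a 0) (Num.max b 0) (Num.max c 0) (Num.max (- a) 0) (Num.max (- b) 0)
  (Num.max (- c) 0) => p1 p2 p3 n1 n2 n3.
by clear => -[[[[[h1 h2] h3] h4] h5] h6]; lia.
Qed.

(** The positive part of [u - v] is at most that of [u] plus that of [-v], so both signs contribute
    at most [P + Q]. *)
Lemma znorm_sub_anticode P Q a b c a' b' c' :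
  int_in_anticode P Q a b c -> int_in_anticode P Q a' b' c' ->
  znorm (a - a') (b - b') (c - c') <= 2 * (P + Q)%:Z.
Proof.
have le_max (u v : int) : Num.max (u - v) 0 <= Num.max u 0 + Num.max (- v) 0 by lia.
have le_maxN (u v : int) : Num.max (- (u - v)) 0 <= Num.max (- u) 0 + Num.max v 0 by lia.
move=> /andP[p n] /andP[p' n']; apply: znorm_le.
  have := lerD (lerD (le_max a a') (le_max b b')) (le_max c c').
  by move=> /le_trans; apply; rewrite addrACA -addrACA; clear - p n'; lia.
have := lerD (lerD (le_maxN a a') (le_maxN b b')) (le_maxN c c').
by move=> /le_trans; apply; clear - n p'; lia.
Qed.

Lemma card_eq_I_enum (T : Type) (S : set T) k : S #= `I_k ->
  exists g : 'I_k -> T, injective g /\ forall i, S (g i).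
Proof.
move=> /card_set_bijP[f [fS finj fsurj]].
have /boolp.choice[g gP] : forall i : 'I_k, exists x, S x /\ f x = i.
  by move=> i; have [x Sx <-] := fsurj i (ltn_ord i); exists x.
exists g; split=> [i j eg|i]; last by case: (gP i).
by apply: val_inj; have [_ /= <-] := gP i; have [_ /= <-] := gP j; rewrite eg.
Qed.

Lemma translate_eq (V : zmodType) (L : set V) x y : is_subgroup L ->
  translate L x = translate L y -> L (x - y).
Proof.
case=> L0 LB e; have : translate L y x by rewrite -e; exists 0; rewrite ?add0r.
by case=> l Ll <-; rewrite addrK.
Qed.

Lemma code_lt3 D (L : set (root_lattice 3)) :
  diameter_perfect_code (@root_dist 3) D L -> (D < 3)%N.
Proof.
case=> -[[L0 LB] _] [_ min_d] [k [index_k [[S diamS cardS] _]]].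
rewrite ltnNge; apply/negP => D3.
have pack a b c : L (root3 a b c) -> znorm a b c <= (2 * D)%:Z -> [/\ a = 0, b = 0 & c = 0].
  move=> Lp le_p; apply: root3_inj; rewrite root3_0; apply: contrapT => p0.
  have := min_d _ Lp p0; rewrite -root3_0 leNgt => /negP; apply.
  rewrite (@le_lt_trans _ _ D%:R) ?ltr_nat // root_dist_le.
  by move: le_p; rewrite /znorm !sub0r !normrN -!opprD normrN.
have [g [g_inj gS]] := card_eq_I_enum cardS.
have le_k : (k <= cut_cube_size D (odd D./2) D./2 D./2 D./2 D./2)%N.
  apply: (@anticode_bound D k (fun i => root_val (g i) 0 (inord 0))
    (fun i => root_val (g i) 0 (inord 1)) (fun i => root_val (g i) 0 (inord 2))).
    by move=> i j [e0 e1 e2]; apply: g_inj; rewrite (root3E (g i)) e0 e1 e2 -root3E.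
  by move=> i j; rewrite -root_dist_le -!root3E; apply: diamS.
have /card_set_bijP[f [f_lt f_inj _]] := index_k.
have idx_lt z : (f (translate L z) < k)%N by apply: f_lt; exists z.
pose idx z : 'I_k := Ordinal (idx_lt z).
have idx_eq y z : idx y = idx z -> L (y - z).
  move=> /(congr1 val) /= e; apply: translate_eq => //.
  by apply: f_inj e; rewrite inE; eexists.
pose pt (p : 'I_D.+1 * 'I_D.+1 * 'I_D.+1) : root_lattice 3 :=
  let '(a, b, c) := cube_point D./2 p.1.1 p.1.2 p.2 in root3 a b c.
set X := [set p : 'I_D.+1 * 'I_D.+1 * 'I_D.+1 |
  in_cut_cube D (odd D./2) D./2 D./2 D./2 D./2 p.1.1 p.1.2 p.2]%SET.
have anti p : p \in X -> exists a b c, pt p = root3 a b c /\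
    int_in_anticode (uphalf D) D./2 a b c.
  rewrite inE => Xp; have := cube_point_in_anticode (leq_ord _) (leq_ord _) (leq_ord _) Xp.
  by rewrite /pt; case: (cube_point _ _ _ _) => [[a b] c] ?; exists a, b, c.
(* Points of the anticode in one coset differ by a lattice vector of norm at most [2 * D], hence by
   [0]. *)
have idx_inj : {in X &, injective (fun p => idx (pt p))}.
  move=> p q Xp Xq /idx_eq.
  have [a [b [c [Ep Sp]]]] := anti p Xp; have [a' [b' [c' [Eq Sq]]]] := anti q Xq.
  rewrite Ep Eq root3B => /pack[].
    by apply: le_trans (znorm_sub_anticode Sp Sq) _; lia.
  move=> /eqP; rewrite subr_eq0 => /eqP ea /eqP; rewrite subr_eq0 => /eqP eb.
  move=> /eqP; rewrite subr_eq0 => /eqP ec.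
  have : cube_point D./2 p.1.1 p.1.2 p.2 = cube_point D./2 q.1.1 q.1.2 q.2.
    move: Ep Eq; rewrite /pt; case: (cube_point _ _ _ _) => [[? ?] ?];
      case: (cube_point _ _ _ _) => [[? ?] ?].
    by rewrite ea eb ec => /root3_inj[-> -> ->] /root3_inj[-> -> ->].
  move: Xp Xq; rewrite !inE => Xp Xq /(cube_point_inj erefl Xp Xq)[].
  case: p q {Ep Eq Xp Xq} => [[? ?] ?] [[? ?] ?] /=.
  by move=> /val_inj-> /val_inj-> /val_inj->.
(* By [le_k] there are at least [k] points, so their injection into the [k] cosets is onto: the
   anticode covers. *)
have img : [set idx (pt p) | p in X]%SET = [set: 'I_k]%SET.
  apply/eqP; rewrite eqEcard finset.subsetT cardsT card_ord card_in_imset //.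
  by rewrite /X -cube_sum_card.
apply: (@no_int_tiling D (fun a b c => L (root3 a b c)) D3) => //.
- by rewrite root3_0.
- by move=> *; rewrite -root3B; apply: LB.
- move=> a b c.
  have : idx (root3 a b c) \in [set idx (pt p) | p in X]%SET by rewrite img inE.
  case/imsetP => p /anti[a' [b' [c' [Ep Sp]]]] /idx_eq; rewrite Ep root3B.
  by exists a', b', c'.
Qed.

(** * Ranks and sublattices defined by a congruence *)

Lemma Zindependent_row_le n s (b : 'I_s -> 'rV[int]_n) : Zindependent b -> (s <= n)%N.
Proof.
move=> ind; rewrite leqNgt; apply/negP => lt_ns.
pose B : 'M[rat]_(s, n) := \matrix_(i, j) (b i 0 j)%:~R.
have : kermx B != 0.
  rewrite -mxrank_eq0 mxrank_ker subn_eq0 -ltnNge.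
  exact: leq_ltn_trans (rank_leq_col B) lt_ns.
case/rowV0Pn => v /sub_kermxP vB /eqP v0; apply: v0.
(* The rational relation [v] times the product of all its denominators. *)
pose c i := numq (v 0 i) * \prod_(j | j != i) denq (v 0 j).
have cE i : (c i)%:~R = v 0 i * (\prod_j denq (v 0 j))%:~R :> rat.
  by rewrite (bigD1 i) //= /c !rmorphM /= mulrA numqE.
have N0 : (\prod_j denq (v 0 j))%:~R != 0 :> rat.
  by rewrite intr_eq0; apply/prodf_neq0 => j _; exact: denq_neq0.
have c0 : forall i, c i = 0.
  apply: ind; apply/rowP => j; rewrite summxE mxE; apply: (@intr_inj rat).
  rewrite rmorph_sum /=; have /rowP/(_ j) := vB; rewrite !mxE => vBj.
  have := congr1 ( *%R^~ (\prod_j denq (v 0 j))%:~R) vBj.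
  rewrite mul0r mulr_suml => vBjN; apply: etrans vBjN.
  apply: eq_bigr => i _; rewrite !mxE mulrAC -cE.
  by rewrite -[b i *~ c i]scaler_int mxE rmorphM /= intz.
apply/rowP => i; rewrite mxE; apply/eqP.
by rewrite -(mulIr_eq0 _ (mulIf N0)) -cE c0.
Qed.

Lemma has_rank_multiples (V : zmodType) n m (f : {additive V -> 'rV[int]_n})
    (L : set V) : bijective f -> (0 < m)%N -> (forall x, L (x *+ m)) -> has_rank L n.
Proof.
move=> [g fK gK] m_gt0 Lm; split; last first.
  move=> s b _ ind; apply: (@Zindependent_row_le n s (f \o b)) => c c0; apply: ind.
  apply: (can_inj fK); rewrite raddf0 -[RHS]c0 raddf_sum.
  by apply: eq_bigr => i _; rewrite raddfMz.
(* The [m]-fold unit vectors are independent and lie in [L]. *)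
exists (fun i => g (delta_mx 0 i) *+ m); split=> [i|c /(congr1 f)]; first exact: Lm.
rewrite raddf0 raddf_sum => /rowP c0 i; have := c0 i.
rewrite summxE mxE (bigD1 i) //= big1 => [|j ne_ji].
  rewrite addr0 raddfMz raddfMn gK -scaler_int !mxE mulmxnE mxE !eqxx mulr_natr.
  by move/eqP; rewrite mulrn_eq0 intz -[m == 0%N]negbK -lt0n m_gt0 => /eqP.
rewrite raddfMz raddfMn gK -scaler_int !mxE mulmxnE mxE eq_sym (negbTE ne_ji).
by rewrite andbF mul0rn mulr0.
Qed.

Lemma full_rank_multiples (V : zmodType) n m (f : {additive V -> 'rV[int]_n})
    (L : set V) : bijective f -> (0 < m)%N -> is_subgroup L -> (forall x, L (x *+ m)) ->
  full_rank_sublattice L.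
Proof.
move=> bij_f m_gt0 subL Lm; split=> //; exists n.
by split; [apply: (has_rank_multiples bij_f m_gt0) | apply: (has_rank_multiples bij_f (m := 1))].
Qed.

Definition root_coord (z : root_lattice 3) : 'rV[int]_3 :=
  row3 (root_val z 0 (inord 0)) (root_val z 0 (inord 1)) (root_val z 0 (inord 2)).

Lemma root_coordB : zmod_morphism root_coord.
Proof. by move=> y z; rewrite /root_coord row3B !mxE. Qed.

HB.instance Definition _ :=
  GRing.isZmodMorphism.Build (root_lattice 3) 'rV[int]_3 root_coord root_coordB.

Lemma root_coord_bij : bijective root_coord.
Proof.
exists (fun x : 'rV_3 => root3 (x 0 (inord 0)) (x 0 (inord 1)) (x 0 (inord 2))) => [z|x].
  by rewrite !mxE !inordK //= -root3E.
by rewrite /root_coord !mxE !inordK //= -row3E.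
Qed.

Definition multiples_of (V : zmodType) (m : nat) (h : {additive V -> int}) : set V :=
  [set x | (m%:Z %| h x)%Z].

Lemma multiples_subgroup (V : zmodType) m (h : {additive V -> int}) :
  is_subgroup (multiples_of m h).
Proof.
split=> [|x y hx hy]; rewrite /multiples_of /= ?raddf0 ?dvdz0 //.
by rewrite raddfB; exact: rpredB.
Qed.

Lemma multiples_mulrn (V : zmodType) m (h : {additive V -> int}) x :
  multiples_of m h (x *+ m).
Proof. by rewrite /multiples_of /= raddfMn -mulr_natr dvdz_mull // natz. Qed.

Lemma translate_eqP (V : zmodType) (L : set V) x y : is_subgroup L ->
  L (x - y) -> translate L x = translate L y.
Proof.
case=> L0 LB Lxy; have Lyx : L (y - x) by rewrite -opprB -sub0r; exact: LB.
have LD u v : L u -> L v -> L (u + v).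
  by move=> Lu Lv; rewrite -[v]opprK -[- v]sub0r; apply: (LB) => //; apply: LB.
apply/seteqP; split=> _ [l Ll <-].
  by exists (l + (x - y)); [exact: LD | rewrite -addrA subrK].
by exists (l + (y - x)); [exact: LD | rewrite -addrA subrK].
Qed.

Lemma residue_inj m i j : (i < m)%N -> (j < m)%N -> (m%:Z %| i%:Z - j%:Z)%Z -> i = j.
Proof.
by move=> ltim ltjm; rewrite -eqz_mod_dvd !modz_nat eqz_nat !modn_small // => /eqP.
Qed.

Lemma multiples_index (V : zmodType) m (h : {additive V -> int}) (r : nat -> V) :
  (0 < m)%N -> (forall i, (i < m)%N -> (m%:Z %| h (r i) - i%:Z)%Z) ->
  has_index (multiples_of m h) m.
Proof.
move=> m_gt0 hr; rewrite /has_index card_eq_sym; apply/card_set_bijP.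
have subL := multiples_subgroup m h.
exists (fun i => translate (multiples_of m h) (r i)); split.
- by move=> i _; exists (r i).
- move=> i j /set_mem /= lt_i /set_mem /= lt_j /(translate_eq subL).
  rewrite /multiples_of /= raddfB => /dvdzP[q E].
  have /dvdzP[q1 E1] := hr i lt_i; have /dvdzP[q2 E2] := hr j lt_j.
  apply: (@residue_inj m) => //; apply/dvdzP; exists (q - q1 + q2).
  by rewrite mulrDl mulrBl -E -E1 -E2; move: (h (r i)) (h (r j)) => u v; lia.
- move=> _ [x _ <-]; pose i := `|(h x %% m%:Z)%Z|%N.
  have iE : (i%:Z = h x %% m%:Z)%Z by rewrite /i gez0_abs // modz_ge0 // -lt0n.
  have lt_i : (i < m)%N by rewrite -ltz_nat iE ltz_pmod.
  exists i => //; apply: translate_eqP => //.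
  have /dvdzP[q E] := hr i lt_i.
  rewrite /multiples_of /= raddfB; apply/dvdzP; exists (q - (h x %/ m%:Z)%Z).
  by rewrite mulrBl -E -addrA -opprD [Posz i + _]addrC iE -divz_eq.
Qed.

Lemma card_le_I (T : Type) (S : set T) m (f : T -> nat) :
  (forall x, S x -> (f x < m)%N) -> (forall x y, S x -> S y -> f x = f y -> x = y) ->
  S #<= `I_m.
Proof.
move=> f_lt f_inj; apply/pcard_leP/injfunPex; exists f; first by move=> x /f_lt.
by move=> x y /set_mem Sx /set_mem Sy; apply: f_inj.
Qed.

Lemma card_eq_I (T : Type) (S : set T) m (f : T -> nat) (r : nat -> T) :
  (forall x, S x -> (f x < m)%N) -> (forall x y, S x -> S y -> f x = f y -> x = y) ->
  (forall i, (i < m)%N -> S (r i) /\ f (r i) = i) -> S #= `I_m.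
Proof.
move=> f_lt f_inj fr; apply/card_set_bijP; exists f; split.
- by move=> x /f_lt.
- by move=> x y /set_mem Sx /set_mem Sy; apply: f_inj.
- by move=> i /= /fr[Sr fri]; exists (r i).
Qed.

Definition residue (m : nat) (u : int) : nat := `|(u %% m%:Z)%Z|%N.

Lemma residue_lt m u : (0 < m)%N -> (residue m u < m)%N.
Proof.
move=> m_gt0; rewrite -ltz_nat /residue gez0_abs ?modz_ge0 -?lt0n //.
by rewrite ltz_pmod.
Qed.

Lemma residue_eq m u v : (0 < m)%N -> residue m u = residue m v -> (m%:Z %| u - v)%Z.
Proof.
move=> m_gt0 /(congr1 Posz); rewrite /residue !gez0_abs ?modz_ge0 -?lt0n //.
by move/eqP; rewrite eqz_mod_dvd.
Qed.

Lemma residue_small m u i : (i < m)%N -> (m%:Z %| u - i%:Z)%Z -> residue m u = i.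
Proof.
by move=> lt_i; rewrite -eqz_mod_dvd /residue => /eqP->; rewrite modz_nat modn_small.
Qed.

Definition weighted_sum (al be ga : int) (x : 'rV[int]_3) : int :=
  al * x 0 (inord 0) + be * x 0 (inord 1) + ga * x 0 (inord 2).

Lemma weighted_sumB al be ga : zmod_morphism (weighted_sum al be ga).
Proof. by move=> x y; rewrite /weighted_sum !mxE; ring. Qed.

HB.instance Definition _ al be ga :=
  GRing.isZmodMorphism.Build 'rV[int]_3 int (weighted_sum al be ga) (weighted_sumB al be ga).

Lemma weighted_sum_row3 al be ga a b c :
  weighted_sum al be ga (row3 a b c) = al * a + be * b + ga * c.
Proof. by rewrite /weighted_sum !mxE !inordK. Qed.

Lemma root_coord_root3 a b c : root_coord (root3 a b c) = row3 a b c.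
Proof. by rewrite /root_coord !mxE !inordK. Qed.

(** Residues modulo [m] separate the points of any set of diameter at most [D], which therefore has
    at most [m] elements. The anticode attains all residues, so it is optimal and tiles. The last
    hypothesis supplies a lattice vector at distance [D + 1]. *)
Lemma residue_code D m (al be ga : int) : (0 < m)%N ->
  (forall a b c, znorm a b c <= (2 * D)%:Z -> (m%:Z %| al * a + be * b + ga * c)%Z ->
     [/\ a = 0, b = 0 & c = 0]) ->
  (forall i, (i < m)%N -> exists a b c, int_in_anticode (uphalf D) D./2 a b c /\
     (m%:Z %| al * a + be * b + ga * c - i%:Z)%Z) ->
  (exists a b c, znorm a b c = (2 * D.+1)%:Z /\ (m%:Z %| al * a + be * b + ga * c)%Z) ->
  lattice_tiles (anticode_diam 3 D) /\
  exists L : set (root_lattice 3), diameter_perfect_code (@root_dist 3) D L.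
Proof.
move=> m_gt0 pack cov [a0 [b0 [c0 [norm0 dvd0]]]].
pose h : {additive 'rV[int]_3 -> int} := weighted_sum al be ga.
have hE a b c : h (row3 a b c) = al * a + be * b + ga * c by exact: weighted_sum_row3.
have sep y z : (exists a b c a' b' c', [/\ y = row3 a b c, z = row3 a' b' c' &
    znorm (a - a') (b - b') (c - c') <= (2 * D)%:Z]) -> (m%:Z %| h y - h z)%Z -> y = z.
  case=> a [b [c [a' [b' [c' [-> -> le_p]]]]]].
  rewrite -raddfB row3B hE => /(pack _ _ _ le_p)[].
  by move=> /subr0_eq-> /subr0_eq-> /subr0_eq->.
have D_eq : (uphalf D + D./2 = D)%N by lia.
have /boolp.choice[r rP] : forall i, exists p : int * int * int, (i < m)%N ->
    int_in_anticode (uphalf D) D./2 p.1.1 p.1.2 p.2 /\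
    (m%:Z %| al * p.1.1 + be * p.1.2 + ga * p.2 - i%:Z)%Z.
  move=> i; have [lt_i|] := ltnP i m; last by exists (0, 0, 0).
  by have [a [b [c ?]]] := cov i lt_i; exists (a, b, c).
pose rx i := row3 (r i).1.1 (r i).1.2 (r i).2.
have h_rx i : (i < m)%N -> residue m (h (rx i)) = i.
  by move=> lt_i; apply: residue_small => //; rewrite hE; case: (rP i lt_i).
split.
- exists (multiples_of m h); split.
  + apply: (full_rank_multiples (f := idfun) _ m_gt0); first by exists idfun.
      exact: multiples_subgroup.
    exact: multiples_mulrn.
  + move=> l l' Ll Ll' [x [[s Ss <-] [s' Ss' e]]].
    have es : s' = s.
      apply: sep.
        exists (s' 0 (inord 0)), (s' 0 (inord 1)), (s' 0 (inord 2)).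
        exists (s 0 (inord 0)), (s 0 (inord 1)), (s 0 (inord 2)).
        split; [exact: row3E | exact: row3E |].
        move: Ss Ss'; rewrite (row3E s) (row3E s') => /anticodeE Ss /anticodeE Ss'.
        by move: (znorm_sub_anticode Ss' Ss); rewrite !mxE !inordK //= D_eq.
      have -> : h s' - h s = h l - h l'.
        rewrite -!raddfB; congr (h _); apply/eqP.
        by rewrite subr_eq addrAC eq_sym subr_eq addrC e addrC.
      exact: rpredB.
    by move: e; rewrite es => /addrI.
  + apply/seteqP; split=> // x _.
    pose i := residue m (h x); have lt_i : (i < m)%N by apply: residue_lt.
    exists (x - rx i).
      rewrite /multiples_of /= raddfB; apply: residue_eq => //.
      by rewrite h_rx.
    by exists (rx i); [apply/anticodeE; case: (rP i lt_i) | rewrite addrC subrK].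
pose hr : {additive root_lattice 3 -> int} := h \o root_coord.
have rsep y z : root_dist y z <= D%:R -> (m%:Z %| hr y - hr z)%Z -> y = z.
  rewrite (root3E y) (root3E z) root_dist_le => le_p dvd_yz.
  apply: (bij_inj root_coord_bij); apply: sep => //; rewrite !root_coord_root3.
  by do 6 eexists; split.
have anti_dist a b c a' b' c' : int_in_anticode (uphalf D) D./2 a b c ->
    int_in_anticode (uphalf D) D./2 a' b' c' -> root_dist (root3 a b c) (root3 a' b' c') <= D%:R.
  by move=> S S'; rewrite root_dist_le; have := znorm_sub_anticode S S'; rewrite D_eq.
exists (multiples_of m hr); split.
- apply: (full_rank_multiples root_coord_bij m_gt0).
    exact: multiples_subgroup.
  exact: multiples_mulrn.
- split.
    exists (root3 a0 b0 c0); split.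
    + by rewrite /multiples_of /= root_coord_root3 hE.
    + by rewrite -root3_0 => /root3_inj[e1 e2 e3]; move: norm0; rewrite e1 e2 e3.
    + rewrite -root3_0 root_distE (_ : znorm _ _ _ = (2 * D.+1)%:Z); last first.
        by rewrite -norm0 /znorm; lia.
      by rewrite PoszM intrM mulrAC mulfV ?mul1r.
  move=> x; rewrite (root3E x); move: (root_val x 0 _) (root_val x 0 _) (root_val x 0 _).
  move=> c b a; rewrite /multiples_of /= root_coord_root3 hE => dvd_x x0.
  have lt_norm : (2 * D)%:Z < znorm a b c.
    rewrite ltNge; apply/negP => /pack/(_ dvd_x)[e1 e2 e3]; apply: x0.
    by rewrite e1 e2 e3 root3_0.
  rewrite -root3_0 root_distE ler_pdivlMr ?ltr0n // -natrM.
  rewrite -[(_ * _)%:R]/((Posz (D.+1 * 2))%:~R) ler_int.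
  (* [znorm] is even, so a value above [2 * D] is at least [2 * (D + 1)]. *)
  by move: lt_norm; rewrite /znorm; lia.
exists m; split.
  apply: (multiples_index (r := fun i => root3 (r i).1.1 (r i).1.2 (r i).2)) => // i lt_i.
  by rewrite /= root_coord_root3 hE; case: (rP i lt_i).
split.
  exists [set root3 p.1.1 p.1.2 p.2 | p in
    [set p : int * int * int | int_in_anticode (uphalf D) D./2 p.1.1 p.1.2 p.2]].
    by move=> _ _ [p Sp <-] [p' Sp' <-]; apply: anti_dist.
  apply: (card_eq_I (f := fun x => residue m (hr x))
                    (r := fun i => root3 (r i).1.1 (r i).1.2 (r i).2)).
  + by move=> x _; apply: residue_lt.
  + move=> _ _ [p Sp <-] [p' Sp' <-] /(residue_eq m_gt0); apply: rsep.
    exact: anti_dist.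
  + move=> i lt_i; split; first by exists (r i) => //; case: (rP i lt_i).
    by rewrite /= root_coord_root3 h_rx.
move=> S diamS; apply: (card_le_I (f := fun x => residue m (hr x))).
  by move=> x _; apply: residue_lt.
by move=> x y Sx Sy /(residue_eq m_gt0); apply: rsep; apply: diamS.
Qed.

(** The anticode consists of [0] and the unit vectors, with residues [0], [1], [2], [3]. *)
Lemma residue_code1 : lattice_tiles (anticode_diam 3 1) /\
  exists L : set (root_lattice 3), diameter_perfect_code (@root_dist 3) 1 L.
Proof.
apply: (@residue_code 1 4 1 2 3) => //.
- by move=> a b c; rewrite /znorm => h /dvdzP[q E]; split; lia.
- case=> [_|[_|[_|[_|//]]]].
  + by exists 0, 0, 0.
  + by exists 1, 0, 0.
  + by exists 0, 1, 0.
  + by exists 0, 0, 1.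
- by exists 1, 0, 1.
Qed.

(** The anticode consists of [0] and the twelve roots of [A_3], whose residues are the differences
    of [0], [1], [3], [9]. This is a perfect difference set modulo [13], so each residue occurs
    once. *)
Lemma residue_code2 : lattice_tiles (anticode_diam 3 2) /\
  exists L : set (root_lattice 3), diameter_perfect_code (@root_dist 3) 2 L.
Proof.
apply: (@residue_code 2 13 1 3 9) => //.
- by move=> a b c; rewrite /znorm => h /dvdzP[q E]; split; lia.
- case=> [_|[_|[_|[_|[_|[_|[_|[_|[_|[_|[_|[_|[_|//]]]]]]]]]]]]].
  + by exists 0, 0, 0.
  + by exists 1, 0, 0.
  + by exists (-1), 1, 0.
  + by exists 0, 1, 0.
  + by exists 0, 0, (-1).
  + by exists 1, 0, (-1).
  + by exists 0, (-1), 1.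
  + by exists 0, 1, (-1).
  + by exists (-1), 0, 1.
  + by exists 0, 0, 1.
  + by exists 0, (-1), 0.
  + by exists 1, (-1), 0.
  + by exists (-1), 0, 0.
- by exists 1, 1, 1.
Qed.

End RootLattice.

Theorem theorem1p2 (D : nat) (hD : (1 <= D)%N) :
  ((exists L : set (root_lattice 3),
      diameter_perfect_code (@root_dist 3) D L) <->
   lattice_tiles (anticode_diam 3 D)) /\
  (lattice_tiles (anticode_diam 3 D) <-> (D = 1%N \/ D = 2%N)).
Proof.
have small : D = 1%N \/ D = 2%N -> lattice_tiles (anticode_diam 3 D) /\
    exists L : set (root_lattice 3), diameter_perfect_code (@root_dist 3) D L.
  by case=> ->; [exact: residue_code1 | exact: residue_code2].
have lt3 : (D < 3)%N -> D = 1%N \/ D = 2%N.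
  by case: D hD {small} => [|[|[|D]]] // _ _; [left | right].
split; split.
- by case=> L /code_lt3/lt3/small[].
- by move=> /tiles_lt3/lt3/small[].
- by move=> /tiles_lt3/lt3.
- by move=> /small[].
Qed.
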